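(* Let $M,N$ be positive integers, and let $\mathbf{r}=[r_1,\ldots,r_M]$ and $\mathbf{c}=[c_1,\ldots,c_N]$ be positive vectors with $\Vert\mathbf{r}\Vert_1=\Vert\mathbf{c}\Vert_1=:s$. Let $\widetilde{A}\in\mathbb{R}^{M\times N}$ be a positive random matrix, let $A=\mathbb{E}[\widetilde{A}]$, and let $(\mathbf{x},\mathbf{y})$ be the unique pair of positive vectors that satisfies $\Vert\mathbf{x}\Vert_1=\Vert\mathbf{y}\Vert_1$ and scales $A$ to row sums $\mathbf{r}$ and column sums $\mathbf{c}$. Suppose that $\widetilde{A}_{i,j}\in[a_{i,j},b_{i,j}]$ almost surely for all $i\in[M]$ and $j\in[N]$, where $a_{i,j}>0$ and $b_{i,j}$ are deterministic, and denote $a=\min_{i,j}a_{i,j}$, $b=\max_{i,j}b_{i,j}$, and $d=\max_{i,j}\{b_{i,j}-a_{i,j}\}$. Suppose further that $\{\widetilde{A}_{i,j}\}_{j=1}^N$ are independent for each $i\in[M]$, and that $\{\widetilde{A}_{i,j}\}_{i=1}^M$ are independent for each $j\in[N]$. Let $$C_p=\sqrt{2}\left(\frac{bd}{a^2}\right),\qquad C_e=1+2\left(\frac{b}{a}\right)^{7/2}.$$ Then there exists a pair of positive random vectors $(\widetilde{\mathbf{x}},\widetilde{\mathbf{y}})$ that scales $\widetilde{A}$ to row sums $\mathbf{r}$ and column sums $\mathbf{c}$, such that for any $\delta\in(0,1]$, with probability at least $$1-2M\exp\left(-\frac{\delta^2s^2}{C_p^2\Vert\mathbf{c}\Vert_2^2}\right)-2N\exp\left(-\frac{\delta^2s^2}{C_p^2\Vert\mathbf{r}\Vert_2^2}\right),$$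 we have that for all $i\in[M]$ and $j\in[N]$: $$\frac{\vert\widetilde{x}_i-x_i\vert}{x_i}\leq\frac{C_e\,\delta\,s}{M\min_i r_i},\qquad\frac{\vert\widetilde{y}_j-y_j\vert}{y_j}\leq\frac{C_e\,\delta\,s}{N\min_j c_j}.$$
   Context: $[n]=\{1,\ldots,n\}$. A matrix or vector is called positive if all its entries are strictly positive. A pair of vectors $(\mathbf{x},\mathbf{y})\in\mathbb{R}^M\times\mathbb{R}^N$ scales a matrix $B\in\mathbb{R}^{M\times N}$ to row sums $\mathbf{r}$ and column sums $\mathbf{c}$ if $\sum_{j=1}^N x_iB_{i,j}y_j=r_i$ for all $i\in[M]$ and $\sum_{i=1}^M x_iB_{i,j}y_j=c_j$ for all $j\in[N]$. For a positive matrix $B$ and positive $\mathbf{r},\mathbf{c}$ with $\Vert\mathbf{r}\Vert_1=\Vert\mathbf{c}\Vert_1$, there is exactly one pair of positive vectors $(\mathbf{x},\mathbf{y})$ with $\Vert\mathbf{x}\Vert_1=\Vert\mathbf{y}\Vert_1$ that scales $B$ to row sums $\mathbf{r}$ and column sums $\mathbf{c}$. In the statement, $(\widetilde{\mathbf{x}},\widetilde{\mathbf{y}})$ does not depend on $\delta$, and need not satisfy $\Vert\widetilde{\mathbf{x}}\Vert_1=\Vert\widetilde{\mathbf{y}}\Vert_1$. *)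

(* Defs.v *)
(* MathComp / MathComp-Analysis. *)
From HB Require Import structures.
From mathcomp Require Import all_boot all_order all_algebra.
From mathcomp Require Import all_classical all_reals all_analysis.

Set Implicit Arguments.
Unset Strict Implicit.
Unset Printing Implicit Defensive.

Import Order.TTheory GRing.Theory Num.Theory.
Import numFieldNormedType.Exports.

Local Open Scope classical_set_scope.
Local Open Scope ring_scope.

Definition norm1 (R : realType) (n : nat) (v : 'rV[R]_n) : R :=
  \sum_(j < n) `|v 0 j|.

Definition norm2 (R : realType) (n : nat) (v : 'rV[R]_n) : R :=
  Num.sqrt (\sum_(j < n) `|v 0 j| ^+ 2).

(* The initial value of the iterated min / max is itself one of the values of
   f, so these are the true minimum and maximum as soon as I is inhabited; for
   I empty both are 0. *)
Definition fin_min (R : realType) (I : finType) (f : I -> R) : R :=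
  \big[Num.min/head 0 (codom f)]_(v <- codom f) v.

Definition fin_max (R : realType) (I : finType) (f : I -> R) : R :=
  \big[Num.max/head 0 (codom f)]_(v <- codom f) v.

Definition positive_mx (R : realType) (m n : nat) (B : 'M[R]_(m, n)) : Prop :=
  forall i j, 0 < B i j.

Definition scales (R : realType) (m n : nat) (B : 'M[R]_(m, n))
    (r : 'rV[R]_m) (c : 'rV[R]_n) (x : 'rV[R]_m) (y : 'rV[R]_n) : Prop :=
  (forall i, \sum_(j < n) x 0 i * B i j * y 0 j = r 0 i) /\
  (forall j, \sum_(i < m) x 0 i * B i j * y 0 j = c 0 j).

Definition mutually_independent (disp : measure_display)
    (T : measurableType disp) (R : realType) (P : probability T R)
    (I : finType) (X : I -> {RV P >-> R}) : Prop :=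
  forall (J : {set I}) (B : I -> set R), (forall i, measurable (B i)) ->
    P (\bigcap_(i in [set` J]) (X i @^-1` B i)) =
    (\prod_(i in J) P (X i @^-1` B i))%E.

(* A random m x n matrix (resp. random row vector of length n) is given by the
   family of its entries; these are its realizations at an outcome w. *)
Definition mx_at (disp : measure_display) (T : measurableType disp)
    (R : realType) (P : probability T R) (m n : nat)
    (X : 'I_m -> 'I_n -> {RV P >-> R}) (w : T) : 'M[R]_(m, n) :=
  \matrix_(i < m, j < n) X i j w.

Definition rv_at (disp : measure_display) (T : measurableType disp)
    (R : realType) (P : probability T R) (n : nat)
    (X : 'I_n -> {RV P >-> R}) (w : T) : 'rV[R]_n :=
  \row_(j < n) X j w.

(* exp(- u / v) for u, v >= 0, computed in the extended reals, where
   0^-1 = +oo and expeR -oo = 0: for u > 0 and v = 0 its value is 0, the limit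
   as v tends to 0 from above. *)
Definition exp_neg_ratio (R : realType) (u v : R) : \bar R :=
  expeR (- (u%:E / v%:E))%E.

(* Main.v *)
Require Import Defs.
From HB Require Import structures.
From mathcomp Require Import all_boot all_order all_algebra.
From mathcomp Require Import all_classical all_reals all_analysis.
From mathcomp Require Import measurable_realfun.
From mathcomp Require Import ring lra.

Import Order.TTheory GRing.Theory Num.Theory.
Import numFieldNormedType.Exports.

Local Open Scope classical_set_scope.
Local Open Scope ring_scope.

(** Write xt_i = x_i u_i and yt_j = y_j v_j, and Q_ij = x_i At_ij y_j. The row
    sums of Q are weighted sums of independent bounded variables with mean r_i,
    and x_i y_j <= r_i c_j b / (a^2 s), so Hoeffding's inequality, applied to
    every row and column, gives that off an event of the stated probability the
    marginals of Q are within relative error e = delta / 2 of r and c. Now (u, v)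
    scales Q to (r, c) exactly. If u is maximal at k, column j0, where v is
    minimal, forces u_k v_j0 >= 1 / (1 + e), so row k forces the Q_k-weighted
    average of v - v_j0 to be at most 2 e v_j0; any two rows of Q are comparable
    up to (b / a)^2 after normalization, so u_i v_j0 is within O(e (b / a)^2) of 1
    for every i. Normalizing by min u = min v, a choice independent of delta,
    turns this into bounds on u and v themselves. The random scaling is the
    pointwise limit of Sinkhorn's iteration, hence measurable. *)

(** * Perturbation of scaling factors *)

Section perturbation.
Context {R : realFieldType} {I J : finType}.

(** Put [t = v j0], the minimum of [v]. Replacing [v] by [t] in row [i] can only decrease the row
    sum, which gives the left inequality. For the right one, the row with maximal [u] bounds the
    weighted excess of [v] over [t], and [kappa] transfers this bound to row [i]. *)
Lemma scaling_ratio_bounds {P : I -> J -> R} {r : I -> R} {c : J -> R}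
    {u : I -> R} {v : J -> R} {e kappa : R} (j0 : J) :
  (forall i j, 0 < P i j) -> (forall i, 0 < r i) -> (forall j, 0 < c j) ->
  (forall i, 0 < u i) -> (forall j, 0 < v j) ->
  (forall i, (1 - e) * r i <= \sum_j P i j <= (1 + e) * r i) ->
  (forall j, \sum_i P i j <= (1 + e) * c j) ->
  (forall i k j, P i j * r k <= kappa * (P k j * r i)) ->
  (forall i, \sum_j u i * P i j * v j = r i) ->
  (forall j, \sum_i u i * P i j * v j = c j) ->
  (forall j, v j0 <= v j) ->
  forall i, (1 - e) * (v j0 * u i) <= 1 <= (1 + e * (1 + 2 * kappa)) * (v j0 * u i).
Proof.
move=> P0 r0 c0 u0 v0 Pr Pc Pk ur vc vmin i.
have rowE k : u k * (\sum_j P k j * (v j - v j0) + v j0 * \sum_j P k j) = r k.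
  rewrite -ur mulr_sumr -big_split/= mulr_sumr.
  by apply: eq_bigr => j _; ring.
have dev_ge0 k j : 0 <= P k j * (v j - v j0).
  by rewrite mulr_ge0// ?subr_ge0// ltW.
have t0 := v0 j0; set t := v j0 in vmin rowE dev_ge0 t0 *.
apply/andP; split.
  rewrite -(ler_pM2r (r0 i)) mul1r -{2}(rowE i).
  rewrite (_ : (1 - e) * (t * u i) * r i = u i * (t * ((1 - e) * r i))); last by ring.
  rewrite ler_pM2l// -[leLHS]add0r lerD ?sumr_ge0//.
  by rewrite ler_pM2l//; case/andP: (Pr i).
have [k ukmax] : exists k, forall i', u i' <= u k.
  by case: (@Order.TotalTheory.arg_maxP _ _ I i xpredT u isT) => k _ h; exists k => i'; exact: h.
(* In column [j0] every [u i'] is at most [u k], and the column sum of [P] exceeds [c j0] by at most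
   the factor [1 + e]. *)
have tuk : 1 <= t * u k * (1 + e).
  rewrite -(ler_pM2r (c0 j0)) mul1r -{1}(vc j0) -/t.
  apply: (@le_trans _ _ (t * u k * \sum_i' P i' j0)).
    rewrite mulr_sumr; apply: ler_sum => i' _.
    rewrite mulrC -mulrA ler_pM2l// ler_pM2r//.
  by rewrite -[leRHS]mulrA ler_pM2l// mulr_gt0.
(* By [tuk], row [k] has total at most [u k * t * (1 + e) * r k]. Cancelling [u k] and removing the
   share of [t], at least [t * (1 - e) * r k], leaves [2 * e * t * r k]. *)
have devk : \sum_j P k j * (v j - t) <= 2 * e * t * r k.
  have {tuk} h : r k <= t * u k * (1 + e) * r k by rewrite ler_peMl// ltW.
  have : u k * (\sum_j P k j * (v j - t) + t * \sum_j P k j) <= u k * (t * (1 + e) * r k).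
    by rewrite rowE (le_trans h)// le_eqVlt; apply/orP; left; apply/eqP; ring.
  rewrite ler_pM2l//.
  have : t * ((1 - e) * r k) <= t * \sum_j P k j by rewrite ler_pM2l//; case/andP: (Pr k).
  lra.
have devi : \sum_j P i j * (v j - t) <= kappa * (2 * e * t) * r i.
  rewrite -(ler_pM2r (r0 k)).
  (* The row comparison of [i] with itself forces even [1 <= kappa]. *)
  have k0 : 0 <= kappa.
    have := Pk i i j0; have : 0 < P i j0 * r i by rewrite mulr_gt0.
    set z := P i j0 * r i => z0 h; nra.
  apply: (@le_trans _ _ (kappa * r i * \sum_j P k j * (v j - t))).
    rewrite mulr_suml mulr_sumr; apply: ler_sum => j _.
    rewrite mulrAC (_ : kappa * r i * _ = kappa * (P k j * r i) * (v j - t)); last by ring.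
    by rewrite ler_wpM2r ?subr_ge0.
  apply: (@le_trans _ _ (kappa * r i * (2 * e * t * r k))).
    by rewrite ler_wpM2l// mulr_ge0// ltW.
  by rewrite le_eqVlt; apply/orP; left; apply/eqP; ring.
rewrite -(ler_pM2r (r0 i)) mul1r -{1}(rowE i).
have : t * \sum_j P i j <= t * ((1 + e) * r i) by rewrite ler_pM2l//; case/andP: (Pr i).
rewrite (_ : (1 + e * (1 + 2 * kappa)) * (t * u i) * r i =
  u i * (kappa * (2 * e * t) * r i + t * ((1 + e) * r i))); last by ring.
by move=> h; rewrite ler_pM2l// lerD.
Qed.

(** Here [t] is the common minimum of both families of ratios. The last hypothesis keeps [t] from
    falling far below 1, which bounds [u >= t] from below; then [(1 - e) * (t * u) <= 1] bounds [u]
    from above. *)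
Lemma normalized_ratio_dist {t u e K : R} : 0 < t -> t <= u -> 0 <= e <= 2^-1 -> 0 <= K ->
  (1 - e) * (t * u) <= 1 -> 1 <= (1 + e * K) * (t * t) -> `|u - 1| <= e * (2 + K).
Proof.
move=> t0 tu /andP[e0 e2] K0 h1 h2.
have eK : 0 <= e * K by rewrite mulr_ge0.
(* A square root of the last hypothesis, since [1 + z <= (1 + z / 2) ^+ 2]. *)
have tK : 1 <= (1 + e * K / 2) * t.
  rewrite leNgt; apply/negP => lt1.
  have : ((1 + e * K / 2) * t) ^+ 2 < 1.
    by rewrite expr_lt1// mulr_ge0 ?(ltW t0)//; lra.
  have := sqr_ge0 (e * K / 2 * t).
  rewrite !exprMn sqrrD expr1n mul1r (expr2 t).
  lra.
rewrite ler_norml; apply/andP; split.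
  case: (leP 1 t) => t1; first by have := mulr_ge0 e0 (addr_ge0 (ler0n _ 2) K0); lra.
  have : (e * K / 2) * t <= e * K / 2 by apply: ler_piMr; [lra|exact: ltW].
  lra.
rewrite lerBlDr.
have e1 : 0 < 1 - e by lra.
(* With [t] cancelled, the claim is [1 + e * K / 2 <= (1 - e) * (1 + e * (2 + K))], where
   [e <= 1 / 2] absorbs the quadratic term. *)
rewrite -(ler_pM2l (mulr_gt0 e1 t0)) -[leLHS]mulrA (le_trans h1)// (le_trans tK)//.
rewrite -[leRHS]mulrA mulrCA mulrC ler_pM2l//.
have : e * (e * (2 + K)) <= 2^-1 * (e * (2 + K)).
  by rewrite ler_wpM2r// mulr_ge0// addr_ge0.
lra.
Qed.

(** Division by [r i] cancels [x i]: the normalized entry is [B i j * y j] over the sum of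
    [A i l * y l], hence lies between [a / b] and [b / a] times [y j / Y]. Two such values differ by
    a factor of at most [(b / a) ^+ 2]. *)
Lemma row_profile_le {A B : I -> J -> R} {x r : I -> R} {y : J -> R} {a b : R} :
  0 < a -> (forall i j, a <= A i j <= b) -> (forall i j, a <= B i j <= b) ->
  (forall i, 0 < x i) -> (forall j, 0 < y j) ->
  (forall i, \sum_j x i * A i j * y j = r i) ->
  forall i k j, x i * B i j * y j * r k <= (b / a) ^+ 2 * (x k * B k j * y j * r i).
Proof.
move=> a0 Ab Bb x0 y0 rE i k j.
have rE' l : r l = x l * \sum_j A l j * y j.
  by rewrite -rE mulr_sumr; apply: eq_bigr => ? _; rewrite mulrA.
set Y := \sum_j y j.
have Y0 : 0 <= Y by rewrite sumr_ge0// => ? _; rewrite ltW.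
have Ayb : \sum_j A k j * y j <= b * Y.
  by rewrite mulr_sumr ler_sum// => l _; rewrite ler_pM2r//; case/andP: (Ab k l).
have aAy : a * Y <= \sum_j A i j * y j.
  by rewrite mulr_sumr ler_sum// => l _; rewrite ler_pM2r//; case/andP: (Ab i l).
have Bi0 : 0 <= B i j by apply: le_trans (ltW a0) _; case/andP: (Bb i j).
have Ak0 : 0 <= \sum_j A k j * y j.
  rewrite sumr_ge0// => l _; rewrite mulr_ge0// ?(ltW (y0 l))//.
  by apply: le_trans (ltW a0) _; case/andP: (Ab k l).
have h : B i j * (\sum_j A k j * y j) <= (b / a) ^+ 2 * (B k j * \sum_j A i j * y j).
  apply: (@le_trans _ _ (b * (b * Y))).
    by apply: ler_pM => //; case/andP: (Bb i j).
  apply: (@le_trans _ _ ((b / a) ^+ 2 * (a * (a * Y)))).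
    by rewrite le_eqVlt; apply/orP; left; apply/eqP; field; rewrite gt_eqF.
  have aB : a <= B k j by case/andP: (Bb k j).
  rewrite ler_wpM2l ?sqr_ge0//; apply: ler_pM => //; rewrite ?mulr_ge0//; exact: ltW.
rewrite !rE'.
rewrite [leLHS](_ : _ = x i * x k * y j * (B i j * \sum_l A k l * y l));
  last by ring.
rewrite [leRHS](_ : _ = x i * x k * y j *
  ((b / a) ^+ 2 * (B k j * \sum_l A i l * y l))); last by ring.
by rewrite ler_pM2l// !mulr_gt0.
Qed.

(** The matrix [A] is the mean and [B] one realization. The ratios [u = xt / x] and [v = yt / y]
    scale [Q] exactly, and the two deviation hypotheses say that [Q] nearly has the right marginals.
    The conclusion concerns [x] only; the one for [y] comes from exchanging rows and columns. *)
Lemma scaling_ratio_dist {A B : I -> J -> R} {a b e t : R} {x xt r : I -> R}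
    {y yt c : J -> R} (i0 : I) (j0 : J) :
  0 < a -> (forall i j, a <= A i j <= b) -> (forall i j, a <= B i j <= b) ->
  (forall i, 0 < x i) -> (forall j, 0 < y j) ->
  (forall i, 0 < xt i) -> (forall j, 0 < yt j) ->
  (forall i, 0 < r i) -> (forall j, 0 < c j) -> 0 <= e <= 2^-1 ->
  (forall i, \sum_j x i * A i j * y j = r i) ->
  (forall j, \sum_i x i * A i j * y j = c j) ->
  (forall i, \sum_j xt i * B i j * yt j = r i) ->
  (forall j, \sum_i xt i * B i j * yt j = c j) ->
  (forall i, `|\sum_j x i * y j / r i * (B i j - A i j)| <= e) ->
  (forall j, `|\sum_i x i * y j / c j * (B i j - A i j)| <= e) ->
  (forall i, t <= xt i / x i) -> (forall j, t <= yt j / y j) ->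
  xt i0 / x i0 = t -> yt j0 / y j0 = t ->
  forall i, `|xt i - x i| / x i <= e * (3 + 2 * (b / a) ^+ 2).
Proof.
move=> a0 Ab Bb x0 y0 xt0 yt0 r0 c0 e01 Ar Ac Br Bc dr dc tx ty xti0 ytj0 i.
pose Q i j := x i * B i j * y j.
pose u i := xt i / x i; pose v j := yt j / y j.
have uQv k l : u k * Q k l * v l = xt k * B k l * yt l.
  by rewrite /u /Q /v; field; rewrite !gt_eqF.
have Qr k : `|\sum_l Q k l - r k| <= e * r k.
  rewrite -{1}(Ar k) -sumrB -ler_pdivrMr// -[X in _ / X](gtr0_norm (r0 k)) -normf_div mulr_suml.
  apply: le_trans (dr k); rewrite le_eqVlt; apply/orP; left; apply/eqP; congr `|_|.
  by apply: eq_bigr => l _; rewrite /Q; ring.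
have Qc l : `|\sum_k Q k l - c l| <= e * c l.
  rewrite -{1}(Ac l) -sumrB -ler_pdivrMr// -[X in _ / X](gtr0_norm (c0 l)) -normf_div mulr_suml.
  apply: le_trans (dc l); rewrite le_eqVlt; apply/orP; left; apply/eqP; congr `|_|.
  by apply: eq_bigr => k _; rewrite /Q; ring.
have B0 k l : 0 < B k l by apply: lt_le_trans a0 _; case/andP: (Bb k l).
have H : forall k, (1 - e) * (v j0 * u k) <= 1 <=
    (1 + e * (1 + 2 * (b / a) ^+ 2)) * (v j0 * u k).
  apply: (@scaling_ratio_bounds Q r c u v e ((b / a) ^+ 2) j0) => //.
  - by move=> k l; rewrite !mulr_gt0.
  - by move=> k; rewrite divr_gt0.
  - by move=> l; rewrite divr_gt0.
  - by move=> k; have := Qr k; rewrite ler_norml; lra.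
  - by move=> l; have := Qc l; rewrite ler_norml; lra.
  - exact: row_profile_le a0 Ab Bb x0 y0 Ar.
  - by move=> k; rewrite -Br; apply: eq_bigr => l _.
  - by move=> l; rewrite -Bc; apply: eq_bigr => k _.
  - by move=> l; rewrite {1}/v ytj0; exact: ty.
have -> : `|xt i - x i| / x i = `|u i - 1|.
  rewrite -[X in _ / X](gtr0_norm (x0 i)) -normf_div mulrBl divff// gt_eqF//.
have -> : e * (3 + 2 * (b / a) ^+ 2) = e * (2 + (1 + 2 * (b / a) ^+ 2)) by ring.
have t0 : 0 < t by rewrite -xti0 divr_gt0.
apply: (normalized_ratio_dist t0) => //.
- exact: tx.
- by rewrite addr_ge0// mulr_ge0// sqr_ge0.
- by have /andP[+ _] := H i; rewrite /v ytj0.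
(* In row [i0] both ratios equal [t], so the upper estimate there becomes a lower bound on
   [t * t]. *)
- by have /andP[_] := H i0; rewrite /v /u ytj0 xti0.
Qed.

(** With [X] and [Y] the sums of [x] and [y], the row gives [x i * a * Y <= r i], the column gives
    [y j * a * X <= c j], and the total gives [s <= b * X * Y]; multiply the three. This controls
    the weights in Hoeffding's inequality. *)
Lemma scaling_factors_le {A : I -> J -> R} {a b s : R} {x r : I -> R} {y c : J -> R} :
  0 < a -> (forall i j, a <= A i j <= b) ->
  (forall i, 0 < x i) -> (forall j, 0 < y j) ->
  (forall i, \sum_j x i * A i j * y j = r i) ->
  (forall j, \sum_i x i * A i j * y j = c j) ->
  \sum_i r i = s ->
  forall i j, x i * y j * (a ^+ 2 * s) <= r i * c j * b.
Proof.
move=> a0 Ab x0 y0 Ar Ac rs i j.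
have aA k l : a <= A k l by case/andP: (Ab k l).
have b0 : 0 < b by case/andP: (Ab i j) => ? ?; lra.
set X := \sum_k x k; set Y := \sum_l y l.
have X0 : 0 <= X by apply: sumr_ge0 => k _; exact: ltW.
have Y0 : 0 <= Y by apply: sumr_ge0 => k _; exact: ltW.
have sXY : s <= b * X * Y.
  rewrite -rs -mulrA mulr_suml mulr_sumr; apply: ler_sum => k _.
  rewrite -Ar mulr_sumr mulr_sumr; apply: ler_sum => l _.
  rewrite mulrA (mulrC b) ler_pM2r// ler_pM2l//; by case/andP: (Ab k l).
have rY : x i * a * Y <= r i.
  by rewrite -Ar mulr_sumr; apply: ler_sum => l _; rewrite ler_pM2r// ler_pM2l.
have cX : y j * a * X <= c j.
  rewrite -Ac mulr_sumr; apply: ler_sum => k _.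
  by rewrite mulrC mulrA mulrAC ler_pM2r// ler_pM2l.
apply: (@le_trans _ _ (x i * y j * (a ^+ 2 * (b * X * Y)))).
  by rewrite ler_pM2l ?mulr_gt0// ler_pM2l// exprn_gt0.
rewrite (_ : _ * _ = x i * a * Y * (y j * a * X) * b); last by ring.
by rewrite ler_pM2r// ler_pM// !mulr_ge0// ltW.
Qed.

End perturbation.

(** * Sinkhorn's iteration *)

Lemma pos_bounds {R : realFieldType} {K : finType} (k0 : K) (f : K -> R) :
  (forall k, 0 < f k) -> exists a b, 0 < a /\ forall k, a <= f k <= b.
Proof.
move=> f0.
have [k _ hk] := @Order.TotalTheory.arg_minP _ _ K k0 xpredT f isT.
have [l _ hl] := @Order.TotalTheory.arg_maxP _ _ K k0 xpredT f isT.
by exists (f k), (f l); split=> // i; apply/andP; split; [exact: hk|exact: hl].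
Qed.

Lemma cvg_fin_sum {R : realType} {K : finType} (f : nat -> K -> R) (l : K -> R) :
  (forall k, f n k @[n --> \oo] --> l k) ->
  \sum_k f n k @[n --> \oo] --> \sum_k l k.
Proof.
by move=> fl; apply: cvg_big => [|k _]; [exact: add_continuous|exact: fl].
Qed.

Section sinkhorn.
Context {R : realType} {I J : finType}.
Implicit Types (B : I -> J -> R) (r : I -> R) (c : J -> R) (y : J -> R).

(** Sinkhorn's iteration is kept in the column variable alone: this is the row scaling that [y]
    forces, and one step corrects all rows, then all columns. *)
Definition row_factor B r y i : R := r i / \sum_j B i j * y j.

Definition sinkhorn_step B r c y j : R :=
  c j / \sum_i row_factor B r y i * B i j.

Definition sinkhorn B r c n : J -> R :=
  iter n (sinkhorn_step B r c) (fun=> 1).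

Context {B : I -> J -> R} {r : I -> R} {c : J -> R} (i0 : I) (j0 : J).
Hypotheses (B_gt0 : forall i j, 0 < B i j) (r_gt0 : forall i, 0 < r i)
  (c_gt0 : forall j, 0 < c j).

Let sumr_gt0 (K : finType) (k0 : K) (f : K -> R) :
  (forall k, 0 < f k) -> 0 < \sum_k f k.
Proof.
move=> f0; rewrite (bigD1 k0)//= ltr_wpDr// sumr_ge0// => k _; exact: ltW.
Qed.

Lemma row_factor_gt0 y : (forall j, 0 < y j) -> forall i, 0 < row_factor B r y i.
Proof.
by move=> y0 i; rewrite divr_gt0// (sumr_gt0 _ j0)// => j; rewrite mulr_gt0.
Qed.

Lemma sinkhorn_step_gt0 y :
  (forall j, 0 < y j) -> forall j, 0 < sinkhorn_step B r c y j.
Proof.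
move=> y0 j; rewrite divr_gt0// (sumr_gt0 _ i0)// => i.
by rewrite mulr_gt0// row_factor_gt0.
Qed.

Lemma sinkhorn_gt0 n j : 0 < sinkhorn B r c n j.
Proof. by elim: n j => [|n IH] j //=; exact: sinkhorn_step_gt0. Qed.

Lemma row_factorK y i : (forall j, 0 < y j) ->
  \sum_j row_factor B r y i * B i j * y j = r i.
Proof.
move=> y0; under eq_bigr do rewrite -mulrA.
rewrite -mulr_sumr divfK// gt_eqF// (sumr_gt0 _ j0)// => j; exact: mulr_gt0.
Qed.

Lemma sinkhorn_stepK y j : (forall j, 0 < y j) ->
  \sum_i row_factor B r y i * B i j * sinkhorn_step B r c y j = c j.
Proof.
move=> y0; rewrite -mulr_suml mulrC divfK// gt_eqF// (sumr_gt0 _ i0)// => i.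
by rewrite mulr_gt0// row_factor_gt0.
Qed.

(** The step depends on [y] only through the row sums of [B] weighted by [y], is increasing in them
    and homogeneous of degree one. The comparison is assumed for these sums instead of for [y],
    because contraction arises in passing from [y] to the sums. *)
Lemma sinkhorn_step_ge y y' (m : R) : 0 < m -> (forall j, 0 < y j) ->
  (forall j, 0 < y' j) ->
  (forall i, m * (\sum_j B i j * y j) <= \sum_j B i j * y' j) ->
  forall j, m * sinkhorn_step B r c y j <= sinkhorn_step B r c y' j.
Proof.
move=> m0 y0 y'0 my j.
have s0 z : (forall j, 0 < z j) -> 0 < \sum_i row_factor B r z i * B i j.
  by move=> z0; rewrite (sumr_gt0 _ i0)// => i; rewrite mulr_gt0// row_factor_gt0.
have t0 z : (forall j, 0 < z j) -> forall i, 0 < \sum_j B i j * z j.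
  by move=> z0 i; rewrite (sumr_gt0 _ j0)// => k; rewrite mulr_gt0.
have le_ratio (k a b : R) : 0 < k -> 0 < a -> 0 < b -> (m * (k / a) <= k / b) = (m * b <= a).
  move=> k0 a0 b0; rewrite mulrA ler_pdivrMr// mulrAC ler_pdivlMr// (mulrC m) -mulrA.
  by rewrite ler_pM2l.
rewrite le_ratio ?s0// mulr_sumr; apply: ler_sum => i _.
by rewrite mulrA ler_pM2r// le_ratio ?t0.
Qed.

Lemma sinkhorn_step_le y y' (m : R) : 0 < m -> (forall j, 0 < y j) ->
  (forall j, 0 < y' j) ->
  (forall i, \sum_j B i j * y' j <= m * (\sum_j B i j * y j)) ->
  forall j, sinkhorn_step B r c y' j <= m * sinkhorn_step B r c y j.
Proof.
move=> m0 y0 y'0 my j; rewrite -ler_pdivrMl//.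
apply: sinkhorn_step_ge; rewrite ?invr_gt0// => i.
by rewrite ler_pdivrMl.
Qed.

(* Each row of B, weighted by y and normalized, dominates (a / b) times the
   probability vector y / \sum y; this common part does not contribute to the
   oscillation of y' / y, which therefore contracts by 1 - a / b. *)
Lemma sinkhorn_osc {a b : R} {y} {m m' : R} : 0 < a -> (forall i j, a <= B i j <= b) ->
  (forall j, 0 < y j) -> 0 < m -> let y' := sinkhorn_step B r c y in
  (forall j, m * y j <= y' j <= m' * y j) ->
  exists k k', [/\ m <= k, k' <= m', k' - k = (1 - a / b) * (m' - m) &
    forall j, k * y' j <= sinkhorn_step B r c y' j <= k' * y' j].
Proof.
move=> a0 Bab y0 m0 y' my.
have y'0 : forall j, 0 < y' j by exact: sinkhorn_step_gt0.
have b0 : 0 < b by case/andP: (Bab i0 j0) => h1 h2; lra.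
set Y := \sum_j y j; set Y' := \sum_j y' j.
have Y0 : 0 < Y by exact: sumr_gt0.
have mY : m * Y <= Y'.
  by rewrite mulr_sumr ler_sum// => j _; case/andP: (my j).
have Ym : Y' <= m' * Y.
  by rewrite mulr_sumr ler_sum// => j _; case/andP: (my j).
have bY0 : 0 < b * Y by rewrite mulr_gt0.
(* In every row, replacing [y'] by [m * y] loses at least [a * (Y' - m * Y)], while the sum weighted
   by [y] is at most [b * Y]. The quotient is the gain in the lower bound; [k'] is symmetric. *)
pose k := m + a * (Y' - m * Y) / (b * Y).
pose k' := m' - a * (m' * Y - Y') / (b * Y).
have mk : m <= k by rewrite lerDl divr_ge0 ?(ltW bY0)// mulr_ge0 ?subr_ge0// ltW.
have kM : k' <= m' by rewrite gerBl divr_ge0 ?(ltW bY0)// mulr_ge0 ?subr_ge0// ltW.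
have By i : 0 <= \sum_j B i j * y j <= b * Y.
  apply/andP; split; first by rewrite sumr_ge0// => j _; rewrite mulr_ge0// ltW.
  by rewrite mulr_sumr ler_sum// => j _; rewrite ler_pM2r//; case/andP: (Bab i j).
have frac i z : 0 <= z -> a * z / (b * Y) * (\sum_j B i j * y j) <= a * z.
  move=> z0; rewrite mulrAC ler_pdivrMr// ler_wpM2l ?(mulr_ge0 (ltW a0))//.
  by case/andP: (By i).
have lo i : k * (\sum_j B i j * y j) <= \sum_j B i j * y' j.
  rewrite mulrDl -lerBrDl; apply: (le_trans (frac _ _ _)); first by rewrite subr_ge0.
  rewrite mulrBr [in a * (m * Y)]mulrCA !mulr_sumr -!sumrB; apply: ler_sum => j _.
  have /andP[h _] := my j; have /andP[h' _] := Bab i j; nra.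
have hi i : \sum_j B i j * y' j <= k' * (\sum_j B i j * y j).
  rewrite mulrBl lerBrDl -lerBrDr; apply: (le_trans (frac _ _ _)); first by rewrite subr_ge0.
  rewrite mulrBr [in a * (m' * Y)]mulrCA !mulr_sumr -!sumrB; apply: ler_sum => j _.
  have /andP[_ h] := my j; have /andP[h' _] := Bab i j; nra.
have k0 : 0 < k by exact: lt_le_trans mk.
exists k, k'; split => //; first by rewrite /k /k'; field; rewrite !gt_eqF.
move=> j; rewrite sinkhorn_step_ge//= sinkhorn_step_le//.
(* Positivity of [k'] remains; it follows from [k <= k'], seen by comparing [lo] and [hi] in row
   [i0]. *)
have By0 : 0 < \sum_j B i0 j * y j by rewrite (sumr_gt0 _ j0)// => j'; rewrite mulr_gt0.
by have := le_trans (lo i0) (hi i0); rewrite ler_pM2r//; exact: lt_le_trans.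
Qed.

Hypothesis rc_sum : \sum_i r i = \sum_j c j.

(** Weighted by the row-corrected matrix, the old and the new [y] have the same total, one through
    the row sums and the other through the column sums. Their ratio therefore averages to 1, so any
    bracket of it contains 1. *)
Lemma sinkhorn_step_mean y (m : R) : (forall j, 0 < y j) ->
  ((forall j, m * y j <= sinkhorn_step B r c y j) -> m <= 1) /\
  ((forall j, sinkhorn_step B r c y j <= m * y j) -> 1 <= m).
Proof.
move=> y0.
have s0 : 0 < \sum_i r i by exact: sumr_gt0.
have E1 : \sum_j \sum_i row_factor B r y i * B i j * y j = \sum_i r i.
  by rewrite exchange_big/=; apply: eq_bigr => i _; rewrite row_factorK.
have E2 : \sum_j \sum_i row_factor B r y i * B i j * sinkhorn_step B r c y j = \sum_i r i.
  by rewrite rc_sum; apply: eq_bigr => j _; rewrite sinkhorn_stepK.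
have x0 i j : 0 < row_factor B r y i * B i j by rewrite mulr_gt0// row_factor_gt0.
split=> my.
  rewrite -(ler_pM2r s0) mul1r -{1}E1 -E2 mulr_sumr; apply: ler_sum => j _.
  by rewrite mulr_sumr; apply: ler_sum => i _; rewrite mulrCA ler_pM2l.
rewrite -(ler_pM2r s0) mul1r -{1}E2 -E1 mulr_sumr; apply: ler_sum => j _.
by rewrite mulr_sumr; apply: ler_sum => i _; rewrite [leRHS]mulrCA ler_pM2l.
Qed.

(** The ratio of consecutive iterates lies in a bracket that contains 1 and whose width shrinks by
    [rho] at each step, so its logarithm is geometrically small. *)
Lemma sinkhorn_log_step : exists rho D : R, [/\ 0 <= rho < 1, 0 <= D &
  forall n j, `|ln (sinkhorn B r c n.+1 j) - ln (sinkhorn B r c n j)| <= D * rho ^+ n].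
Proof.
have [a [b [a0 ab]]] := pos_bounds (i0, j0) (fun k => B k.1 k.2) (fun k => B_gt0 k.1 k.2).
(* The iteration starts at the constant 1, so bounds on the first iterate are bounds on the first
   ratio. *)
have [m0 [M0 [m0_gt0 mM0]]] := pos_bounds j0 _ (sinkhorn_gt0 1).
have Bab i j : a <= B i j <= b by exact: ab (i, j).
have ab0 : a <= b by case/andP: (Bab i0 j0); exact: le_trans.
have b0 : 0 < b by exact: lt_le_trans ab0.
pose rho := 1 - a / b.
have rho01 : 0 <= rho < 1.
  have : 0 < a / b by rewrite divr_gt0.
  have : a / b <= 1 by rewrite ler_pdivrMr// mul1r.
  rewrite /rho; lra.
have bracket n : exists m m', [/\ m0 <= m, m' - m = rho ^+ n * (M0 - m0) &
    forall j, m * sinkhorn B r c n j <= sinkhorn B r c n.+1 j <= m' * sinkhorn B r c n j].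
  elim: n => [|n [m [m' [mm E my]]]].
    by exists m0, M0; rewrite expr0 mul1r; split => // j; rewrite /= !mulr1; exact: mM0.
  have [k [k' [mk _ E' ky]]] := sinkhorn_osc a0 Bab (sinkhorn_gt0 n) (lt_le_trans m0_gt0 mm) my.
  exists k, k'; split; [exact: le_trans mk|by rewrite E' E exprS mulrA|exact: ky].
(* The division by [m0] is for the lower estimate: [- ln q <= (1 - q) / q] and [q >= m >= m0]. *)
exists rho, ((M0 - m0) / m0); split => //.
  by rewrite divr_ge0 ?(ltW m0_gt0)// subr_ge0; case/andP: (mM0 j0); exact: le_trans.
move=> n j; have [m [m' [mm E my]]] := bracket n.
have m1 : m <= 1.
  by have [h _] := sinkhorn_step_mean _ m (sinkhorn_gt0 n); apply: h => k; case/andP: (my k).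
have m'1 : 1 <= m'.
  by have [_ h] := sinkhorn_step_mean _ m' (sinkhorn_gt0 n); apply: h => k; case/andP: (my k).
have y0 := sinkhorn_gt0 n j; have y'0 := sinkhorn_gt0 n.+1 j.
rewrite -ln_div ?posrE//.
set q := _ / _.
have /andP[mq qm'] : m <= q <= m'.
  by rewrite ler_pdivlMr// ler_pdivrMr.
have q0 : 0 < q by rewrite divr_gt0.
rewrite (_ : _ * rho ^+ n = (m' - m) / m0); last by rewrite E; ring.
have m01 : m0 <= 1 by exact: le_trans m1.
have mmle : m' - m <= (m' - m) / m0.
  by rewrite ler_pdivlMr// ler_piMr// subr_ge0; lra.
have ln_le (z : R) : 0 < z -> ln z <= z - 1.
  by move=> z0; have := @le_ln1Dx R (z - 1); rewrite addrCA subrr addr0; apply; lra.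
rewrite ler_norml; apply/andP; split; last by have := ln_le _ q0; lra.
rewrite lerNl -lnV ?posrE//.
apply: (le_trans (ln_le _ _)); first by rewrite invr_gt0.
have -> : q^-1 - 1 = (1 - q) / q by field; rewrite gt_eqF.
rewrite ler_pdivrMr// mulrAC.
have : m' - m <= (m' - m) * q / m0.
  by rewrite ler_pdivlMr// ler_wpM2l ?(le_trans mm)// subr_ge0; exact: le_trans m'1.
lra.
Qed.

(** The increments of the logarithms are dominated by a geometric series, so the logarithms
    converge; the limit of the iterates is an exponential and hence positive. *)
Lemma sinkhorn_cvg : exists y, [/\ forall j, 0 < y j,
  forall j, sinkhorn B r c n j @[n --> \oo] --> y j &
  forall j, sinkhorn_step B r c y j = y j].
Proof.
have [rho [D [/andP[rho0 rho1] D0 step]]] := sinkhorn_log_step.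
pose u j n := ln (sinkhorn B r c n j).
have ucvg j : cvgn (u j).
  have : cvgn (series (telescope (u j))).
    apply: normed_cvg; apply: (@series_le_cvg _ _ (geometric D rho)).
    - by move=> n; exact: normr_ge0.
    - by move=> n; rewrite mulr_ge0// exprn_ge0.
    - by move=> n; exact: step.
    - by apply: is_cvg_geometric_series; rewrite ger0_norm.
  rewrite telescopeK => h.
  rewrite (_ : u j = (fun n => u j n - u j 0%N) \+ cst (u j 0%N)); last first.
    by apply/funext => n /=; rewrite subrK.
  by apply: is_cvgD => //; exact: is_cvg_cst.
pose y j := expR (limn (u j)).
have y0 j : 0 < y j by exact: expR_gt0.
have ycvg j : sinkhorn B r c n j @[n --> \oo] --> y j.
  rewrite (_ : (fun n => _) = expR \o u j); last first.
    by apply/funext => n /=; rewrite lnK// posrE sinkhorn_gt0.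
  by apply: continuous_cvg; [exact: continuous_expR|exact: ucvg].
exists y; split => // j.
(* The shifted sequence has the same limit, and the step is continuous at the positive vector [y];
   uniqueness of limits makes [y] a fixed point. *)
have := ycvg j; rewrite -cvg_shiftS /= => h.
apply/esym; apply: (cvg_unique (@norm_hausdorff _ _) h).
apply: cvgM; first exact: cvg_cst.
apply: cvgV; first by rewrite gt_eqF// (sumr_gt0 _ i0)// => i; rewrite mulr_gt0// row_factor_gt0.
apply: cvg_fin_sum => i; apply: cvgM; last exact: cvg_cst.
apply: cvgM; first exact: cvg_cst.
apply: cvgV; first by rewrite gt_eqF// (sumr_gt0 _ j0)// => k; rewrite mulr_gt0.
by apply: cvg_fin_sum => k; apply: cvgM; [exact: cvg_cst|exact: ycvg].
Qed.

End sinkhorn.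

(** * Hoeffding's inequality *)

Lemma derive_ge0_le {R : realType} (f f' : R -> R) :
  (forall x : R, is_derive x (1 : R) f (f' x)) -> (forall x, 0 <= x -> 0 <= f' x) ->
  forall x, 0 <= x -> f 0 <= f x.
Proof.
move=> df f'0 x; rewrite le_eqVlt => /predU1P[<-//|x0].
have cf : {within `[0, x], continuous f}.
  apply: continuous_subspaceT => z; apply: differentiable_continuous.
  by apply/derivable1_diffP; exact: (@ex_derive _ _ _ _ _ _ _ (df z)).
have [z] := MVT x0 (fun z _ => df z) cf.
rewrite in_itv/= => /andP[z0 _] E.
by rewrite -subr_ge0 E mulr_ge0 ?subr_ge0 ?f'0 ?ltW.
Qed.

(* The logarithm of 1 - p + p e^h has second derivative q (1 - q) <= 1 / 4,
   where q = p e^h / (1 - p + p e^h). *)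
Lemma two_point_mgf_le {R : realType} (p h : R) : 0 <= p <= 1 ->
  (1 - p) * expR (- (h * p)) + p * expR (h * (1 - p)) <= expR (h ^+ 2 / 8).
Proof.
(* Exchanging the two points replaces [(p, h)] by [(1 - p, - h)]. *)
wlog h0 : p h / 0 <= h.
  move=> H p01; case: (leP 0 h) => [h0|/ltW h0]; first exact: H.
  have {}H : (1 - (1 - p)) * expR (- (- h * (1 - p))) + (1 - p) * expR (- h * (1 - (1 - p)))
      <= expR ((- h) ^+ 2 / 8) by apply: H; [rewrite oppr_ge0|lra].
  apply: le_trans (le_trans H _); last by rewrite sqrrN.
  by rewrite le_eqVlt; apply/orP; left; apply/eqP; rewrite addrC !subKr !mulNr opprK.
move=> /andP[p0 p1].
pose g (z : R) : R := 1 - p + p * expR z.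
have g0 z : 0 < g z.
  have := expR_gt0 z; rewrite /g => e0.
  case: (leP (2^-1) p) => hp.
    have : 0 < p * expR z by rewrite mulr_gt0//; lra.
    lra.
  have : 0 <= p * expR z by rewrite mulr_ge0// ltW.
  lra.
pose q (z : R) : R := p * expR z / g z.
have dg (z : R) : is_derive z (1 : R) g (p * expR z).
  by rewrite /g; apply: is_derive_eq; rewrite /GRing.scale/=; ring.
have dq (z : R) : is_derive z (1 : R) q (q z * (1 - q z)).
  have gz : g z != 0 by rewrite gt_eqF.
  have dV := @is_deriveV _ g z _ _ gz (dg z).
  apply: is_derive_eq; rewrite /GRing.scale/= /q; field.
  by rewrite gt_eqF.
have dlng (z : R) : is_derive z (1 : R) (@ln R \o g) (q z).
  have dl := is_derive1_ln (g0 z).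
  apply: is_derive_eq; rewrite /GRing.scale/= /q; ring.
(* [psi] vanishes at 0 and its derivative is the square of [q z - 1 / 2]. *)
pose psi (z : R) : R := z / 4 + p - q z.
have dpsi (z : R) : is_derive z (1 : R) psi (4^-1 - q z * (1 - q z)).
  by rewrite /psi; apply: is_derive_eq; rewrite /GRing.scale/=; ring.
have psi0 z : 0 <= z -> 0 <= psi z.
  move=> z0; have := derive_ge0_le _ _ dpsi _ z z0.
  rewrite {1}/psi /q /g expR0 mulr1 subrK divr1 mul0r add0r subrr; apply=> t _.
  by have := sqr_ge0 (q t - 2^-1); rewrite /q; lra.
(* [phi] is the gap between [z ^+ 2 / 8] and the logarithm of the centered two-point generating
   function; it vanishes at 0 and has derivative [psi]. *)
pose phi (z : R) : R := z ^+ 2 / 8 + z * p - (@ln R \o g) z.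
have dphi (z : R) : is_derive z (1 : R) phi (psi z).
  by rewrite /phi /psi; apply: is_derive_eq; rewrite /GRing.scale/=; field.
have := derive_ge0_le _ _ dphi psi0 h h0.
rewrite {1}/phi /= /g expR0 mulr1 subrK ln1 expr0n/= !mul0r addr0 subrr => phi0.
have -> : (1 - p) * expR (- (h * p)) + p * expR (h * (1 - p)) = expR (ln (g h) - h * p).
  rewrite expRD lnK ?posrE// /g [RHS]mulrDl -[p * _ * _]mulrA -expRD.
  by congr (_ + _ * expR _); ring.
by rewrite ler_expR; move: phi0; rewrite /phi/=; lra.
Qed.

(** * Expectation of a product of independent factors *)

Section independence.
Import HBNNSimple.
Context {disp : measure_display} {T : measurableType disp} {R : realType}
  {P : probability T R}.

(** The factorization passes from indicators to simple functions by linearity and then to [f] by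
    monotone convergence. [G] stands for the product of the other factors; the case of the whole
    line shows that [k] is its integral. *)
Lemma integral_mul_ext {Y G : T -> R} {k : R} :
  measurable_fun setT Y -> measurable_fun setT G -> (forall w, 0 <= G w) ->
  0 <= k ->
  (forall B : set R, measurable B ->
    (\int[P]_w (\1_B (Y w) * G w)%:E = k%:E * P (Y @^-1` B))%E) ->
  forall f : R -> R, measurable_fun setT f -> (forall z, 0 <= f z) ->
  (\int[P]_w (f (Y w) * G w)%:E = k%:E * \int[P]_w (f (Y w))%:E)%E.
Proof.
move=> mY mG G0 k0 H f mf f0.
have mEf : measurable_fun setT (EFin \o f) by exact/measurable_EFinP.
pose h := nnsfun_approx measurableT mEf.
have hf z : (h n z)%:E @[n --> \oo] --> (f z)%:E.
  by apply: cvg_nnsfun_approx => // z' _; rewrite lee_fin.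
have ndh n m z : (n <= m)%N -> h n z <= h m z.
  by move=> nm; exact/lefP/nd_nnsfun_approx.
have mh n : measurable_fun setT (h n \o Y) by exact: measurableT_comp.
have step n : (\int[P]_w (h n (Y w) * G w)%:E = k%:E * \int[P]_w (h n (Y w))%:E)%E.
  pose s := finmap.enum_fset (fset_set (range (h n))).
  pose B (i : 'I_(size s)) := h n @^-1` [set s`_i].
  have mB i : measurable (B i) by exact: measurable_funPTI.
  have mBY i : measurable (Y @^-1` B i) by rewrite -[_ @^-1` _]setTI; exact: mY.
  have m1 i : measurable_fun setT (\1_(B i) \o Y : T -> R).
    by apply: measurableT_comp => //; exact: measurable_indic.
  have s0 (i : 'I_(size s)) : 0 <= s`_i.
    have : s`_i \in s by rewrite mem_nth.
    by rewrite in_fset_set// inE => -[z _ <-].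
  transitivity (\sum_(i < size s) (s`_i)%:E * (k%:E * P (Y @^-1` B i)))%E.
    under eq_integral do rewrite fimfunEord mulr_suml -sumEFin.
    rewrite ge0_integral_sum//; last 2 first.
      - move=> i; apply/measurable_EFinP; apply: measurable_funM => //.
        by apply: measurable_funM => //; exact: m1.
      - by move=> i w _; rewrite lee_fin !mulr_ge0// ?s0// indicE.
    apply: eq_bigr => i _; rewrite -H//.
    under eq_integral do rewrite -mulrA EFinM.
    rewrite ge0_integralZl_EFin//.
    - by move=> w _; rewrite lee_fin mulr_ge0// indicE.
    - by apply/measurable_EFinP; apply: measurable_funM => //; exact: m1.
  under [in RHS]eq_integral do rewrite fimfunEord -sumEFin.
  rewrite ge0_integral_sum//; last 2 first.
    - move=> i; apply/measurable_EFinP.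
      by apply: measurable_funM => //; exact: m1.
    - by move=> i w _; rewrite lee_fin !mulr_ge0// ?s0// indicE.
  rewrite ge0_sume_distrr => [|i _]; last first.
    by apply: integral_ge0 => w _; rewrite lee_fin mulr_ge0// ?s0// indicE.
  apply: eq_bigr => i _; rewrite muleCA; congr (_ * _)%E.
  under eq_integral do rewrite EFinM.
  rewrite ge0_integralZl_EFin//.
  - by congr (_ * _)%E; rewrite -[Y @^-1` _]setIT -integral_indic.
  - by apply/measurable_EFinP; exact: m1.
transitivity (limn (fun n => \int[P]_w (h n (Y w) * G w)%:E))%E.
  rewrite -monotone_convergence//.
  - apply: eq_integral => w _; apply/esym/cvg_lim => //.
    under eq_fun do rewrite EFinM.
    by rewrite EFinM; apply: cvgeZr.
  - by move=> n; apply/measurable_EFinP; apply: measurable_funM => //; exact: mh.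
  - by move=> n w _; rewrite lee_fin mulr_ge0.
  - by move=> w _ n m nm; rewrite lee_fin ler_wpM2r// ndh.
rewrite (_ : (fun n => _) = (fun n => \int[P]_w (k * h n (Y w))%:E)%E); last first.
  apply/funext => n; rewrite step.
  under [in RHS]eq_integral do rewrite EFinM.
  rewrite ge0_integralZl_EFin//.
  - by move=> w _; rewrite lee_fin.
  - exact/measurable_EFinP/mh.
rewrite -monotone_convergence//.
- rewrite -ge0_integralZl_EFin//; last 2 first.
  + by move=> w _; rewrite lee_fin.
  + by apply/measurable_EFinP; exact: measurableT_comp.
  apply: eq_integral => w _; apply/cvg_lim => //.
  under eq_fun do rewrite EFinM.
  by apply: cvgeZl.
- by move=> n; apply/measurable_EFinP; apply: measurable_funM => //; exact: mh.
- by move=> n w _; rewrite lee_fin mulr_ge0.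
- by move=> w _ n m nm; rewrite lee_fin ler_wpM2l// ndh.
Qed.

Lemma integral_indic_preimage (Y : T -> R) (B : set R) : measurable_fun setT Y ->
  measurable B -> (\int[P]_w (\1_B (Y w))%:E = P (Y @^-1` B))%E.
Proof.
move=> mY mB; rewrite -[Y @^-1` B]setIT -integral_indic//.
by rewrite -[_ @^-1` _]setTI; exact: mY.
Qed.

(** For indicators this is the definition of independence; [integral_mul_ext] then frees one factor
    at a time. *)
Lemma independent_integral_prod {I : finType} {X : I -> {RV P >-> R}}
    {f : I -> R -> R} {m : I -> R} :
  mutually_independent X ->
  (forall i, measurable_fun setT (f i)) -> (forall i z, 0 <= f i z) ->
  (forall i, \int[P]_w (f i (X i w))%:E = (m i)%:E)%E ->
  (\int[P]_w (\prod_i f i (X i w))%:E = (\prod_i m i)%:E)%E.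
Proof.
move=> indep.
(* Induction on the set of indices whose factor is not yet an indicator. *)
suff H (s : seq I) : forall (f : I -> R -> R) (m : I -> R), (forall i, measurable_fun setT (f i)) ->
    (forall i z, 0 <= f i z) ->
    (forall i, \int[P]_w (f i (X i w))%:E = (m i)%:E)%E ->
    (forall i, i \notin s -> exists B : set R, measurable B /\ f i = \1_B) ->
    (\int[P]_w (\prod_i f i (X i w))%:E = (\prod_i m i)%:E)%E.
  move=> mf f0 fm; apply: (H (enum I)) => // i.
  by rewrite mem_enum.
have mX i : measurable_fun setT (X i) by exact: measurable_funP.
elim: s => [|k s IH] {}f {}m mf f0 fm fB.
  have [B BE] := choice (fun i => fB i isT).
  have mB i : measurable (B i) by case: (BE i).
  have mXB i : measurable (X i @^-1` B i) by rewrite -[_ @^-1` _]setTI; exact: mX.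
  transitivity (P (\bigcap_(i in [set` [set: I]%SET]) (X i @^-1` B i))).
    rewrite -[X in P X]setIT -integral_indic//; last first.
      by apply: fin_bigcap_measurable => // i _; exact: mXB.
    apply: eq_integral => w _; congr EFin.
    under eq_bigr do rewrite (BE _).2 indicE.
    rewrite indicE; case: (boolP (w \in _)) => [/set_mem wB|/negP wB].
      by rewrite big1// => i _; rewrite mem_set//; apply: wB; rewrite /= inE.
    have [i XB] : exists i, X i w \notin B i.
      apply/not_existsP => h; apply: wB; apply/mem_set => i _.
      by apply/set_mem/negPn/negP; exact: h.
    by rewrite (bigD1 i)//= (negbTE XB) mul0r.
  rewrite indep// (big_morph EFin EFinM erefl).
  apply: eq_big => [i|i _]; first by rewrite inE.
  by rewrite -fm (BE i).2 integral_indic_preimage.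
have mfX i : measurable_fun setT (fun w => f i (X i w)) by exact: measurableT_comp.
rewrite (bigD1 k)//=; under eq_integral do rewrite (bigD1 k)//=.
have m0 i : 0 <= m i.
  by rewrite -lee_fin -fm; apply: integral_ge0 => w _; rewrite lee_fin.
rewrite (@integral_mul_ext (X k) (fun w => \prod_(i | i != k) f i (X i w)) (\prod_(i | i != k) m i))//.
- by rewrite fm -EFinM mulrC.
- under eq_fun do rewrite -big_filter; exact: measurable_prod.
- by move=> w; exact: prodr_ge0.
- exact: prodr_ge0.
move=> B mB.
(* With factor [k] turned into an indicator, the induction hypothesis supplies the factorization
   that [integral_mul_ext] asks for. *)
pose f' i := if i == k then \1_B : R -> R else f i.
pose m' i := if i == k then fine (P (X k @^-1` B)) else m i.
have PB : (fine (P (X k @^-1` B)))%:E = P (X k @^-1` B).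
  by rewrite fineK// fin_num_measure// -[_ @^-1` _]setTI; exact: mX.
have m'k : m' k = fine (P (X k @^-1` B)) by rewrite /m' eqxx.
have f'k : f' k = \1_B by rewrite /f' eqxx.
have := IH f' m'; rewrite [X in (_ = X%:E)%E](bigD1 k)//= m'k => E.
rewrite muleC -PB -EFinM (eq_bigr m') => [|i /negbTE ik]; last by rewrite /m' ik.
rewrite -E.
- apply: eq_integral => w _; rewrite [in RHS](bigD1 k)//= f'k; congr (_ * _)%:E.
  by apply: eq_bigr => i /negbTE ik; rewrite /f' ik.
- by move=> i; rewrite /f'; case: ifP => // _; exact: measurable_indic.
- by move=> i z; rewrite /f'; case: ifP => // _; rewrite indicE.
- move=> i; rewrite /f' /m'; case: ifP => [/eqP ->|_ //].
  by rewrite integral_indic_preimage.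
- move=> i iks; rewrite /f'; case: ifPn => [_|ik]; first by exists B.
  by apply: (fB i); rewrite in_cons negb_or ik.
Qed.

End independence.

(** * Generating functions and tails of bounded variables *)

Section hoeffding.
Context {disp : measure_display} {T : measurableType disp} {R : realType}
  {P : probability T R}.
Implicit Types (X : {RV P >-> R}).

Lemma ae_bounded_integrable {X} {lo hi : R} :
  {ae P, forall w, lo <= X w <= hi} -> P.-integrable setT (EFin \o X).
Proof.
move=> Xb; apply/integrableP; split; first exact/measurable_EFinP.
apply: (@le_lt_trans _ _ (\int[P]_w (`|lo| + `|hi|)%:E)%E); last first.
  by rewrite integral_cst//= probability_setT mule1 ltry.
apply: ae_ge0_le_integral => //.
- exact/measurableT_comp/measurable_EFinP.
apply: filterS Xb => w /andP[h1 h2] _; rewrite /= lee_fin.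
rewrite ler_norml; apply/andP; split.
  by have := ler_norm (- lo); rewrite normrN; have := normr_ge0 hi; lra.
by have := ler_norm hi; have := normr_ge0 lo; lra.
Qed.

Lemma integral_le_affine {X} {lo hi mu : R} {F : T -> R} (k l : R) :
  {ae P, forall w, lo <= X w <= hi} -> ('E_P[X] = mu%:E)%E ->
  measurable_fun setT F -> (forall w, 0 <= F w) ->
  {ae P, forall w, F w <= k * X w + l} ->
  (\int[P]_w (F w)%:E <= (k * mu + l)%:E)%E.
Proof.
move=> Xb; rewrite unlock => E mF F0 FX.
have iX := ae_bounded_integrable Xb.
have mX : measurable_fun setT X by exact: measurable_funP.
have mkX : measurable_fun setT (fun w => (k * X w + l)%:E).
  by apply/measurable_EFinP; apply: measurable_funD => //; exact: measurable_funM.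
have -> : (k * mu + l)%:E = (\int[P]_w (k * X w + l)%:E)%E.
  under eq_integral do rewrite EFinD EFinM.
  rewrite integralD//; last 2 first.
    - exact: integrableZl.
    - exact: finite_measure_integrable_cst.
  by rewrite integralZl// E integral_cst//= probability_setT mule1.
(* The affine majorant is nonnegative only almost surely, so its absolute value serves as the
   majorant in the comparison of integrals. *)
rewrite (@ae_eq_integral _ _ _ P setT (fun w => `|(k * X w + l)%:E|%E) (fun w => (k * X w + l)%:E))//.
- apply: ae_ge0_le_integral => //.
  + by move=> w _; rewrite lee_fin.
  + exact/measurable_EFinP.
  + exact: measurableT_comp.
  + by apply: filterS FX => w FX _; rewrite lee_fin (le_trans FX)// ler_norm.
- exact: measurableT_comp.
- apply: filterS FX => w FX _; rewrite gee0_abs// lee_fin.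
  exact: le_trans FX.
Qed.

Lemma expectation_ae_bounds {X} {lo hi mu : R} :
  {ae P, forall w, lo <= X w <= hi} -> ('E_P[X] = mu%:E)%E -> lo <= mu <= hi.
Proof.
move=> Xb EX; have m0 : measurable_fun setT (cst 0 : T -> R) by [].
(* Take [F = 0] and the almost surely nonnegative functions [X - lo] and [hi - X]. *)
have := integral_le_affine 1 (- lo) Xb EX m0 (fun=> lexx _).
have := integral_le_affine (-1) hi Xb EX m0 (fun=> lexx _).
rewrite integral0 !lee_fin => h1 h2; apply/andP; split.
  have : 0 <= 1 * mu - lo by apply: h2; apply: filterS Xb => w /andP[]; rewrite /=; lra.
  lra.
have : 0 <= -1 * mu + hi by apply: h1; apply: filterS Xb => w /andP[]; rewrite /=; lra.
lra.
Qed.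

Lemma expR_convex_comb (q u v : R) : 0 <= q <= 1 ->
  expR ((1 - q) * u + q * v) <= (1 - q) * expR u + q * expR v.
Proof.
move=> /andP[q0 q1]; set z := _ + _.
have tangent t : expR z * (1 + (t - z)) <= expR t.
  have -> : expR t = expR z * expR (t - z) by rewrite -expRD addrC subrK.
  by rewrite ler_pM2l ?expR_gt0// expR_ge1Dx.
have -> : expR z = (1 - q) * (expR z * (1 + (u - z))) + q * (expR z * (1 + (v - z))).
  by rewrite /z; ring.
by rewrite lerD// ler_wpM2l// subr_ge0.
Qed.

(** By convexity the exponential lies below its chord over [[lo, hi]]. The mean of the chord is the
    generating function of the two-point law on [lo] and [hi] with mean [mu], which
    [two_point_mgf_le] bounds. *)
Lemma hoeffding_lemma {X} {lo hi mu : R} (lambda : R) :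
  {ae P, forall w, lo <= X w <= hi} -> ('E_P[X] = mu%:E)%E ->
  (\int[P]_w (expR (lambda * (X w - mu)))%:E <=
    (expR (lambda ^+ 2 * (hi - lo) ^+ 2 / 8))%:E)%E.
Proof.
move=> Xb EX; have /andP[lomu muhi] := expectation_ae_bounds Xb EX.
have mF : measurable_fun setT (fun w => expR (lambda * (X w - mu))).
  apply: measurableT_comp => //; apply: measurable_funM => //.
  by apply: measurable_funB => //; exact: measurable_funP.
have F0 w : 0 <= expR (lambda * (X w - mu)) by exact: expR_ge0.
have [lohi|hilo] := ltP lo hi; last first.
  (* Here the interval is a point and [X] equals [mu] almost surely; the chord would divide by
     zero. *)
  have -> : lambda ^+ 2 * (hi - lo) ^+ 2 / 8 = 0.
    have -> : hi = lo by apply/le_anti; rewrite hilo (le_trans lomu).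
    by rewrite subrr expr0n mulr0 mul0r.
  rewrite expR0; have := integral_le_affine 0 1 Xb EX mF F0.
  rewrite mul0r add0r; apply; apply: filterS Xb => w Xw.
  have -> : X w = mu by lra.
  by rewrite subrr mulr0 expR0 mul0r add0r.
have d0 : 0 < hi - lo by rewrite subr_gt0.
pose p := (mu - lo) / (hi - lo).
have p01 : 0 <= p <= 1.
  by rewrite /p divr_ge0 ?subr_ge0 ?(ltW lohi)//= ler_pdivrMr// mul1r lerD2r.
pose E1 := expR (lambda * (lo - mu)); pose E2 := expR (lambda * (hi - mu)).
pose k := (E2 - E1) / (hi - lo).
apply: (le_trans (integral_le_affine k (E1 - k * lo) Xb EX mF F0 _)).
  apply: filterS Xb => w Xw.
  pose q := (X w - lo) / (hi - lo).
  have q01 : 0 <= q <= 1.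
    rewrite /q divr_ge0 ?(ltW d0)//=; last by rewrite subr_ge0; case/andP: Xw.
    by rewrite ler_pdivrMr// mul1r lerD2r; case/andP: Xw.
  have := expR_convex_comb q (lambda * (lo - mu)) (lambda * (hi - mu)) q01.
  rewrite -/E1 -/E2 (_ : (1 - q) * E1 + q * E2 = k * X w + (E1 - k * lo)); last first.
    by rewrite /q /k; field; rewrite gt_eqF.
  rewrite (_ : (1 - q) * _ + _ = lambda * (X w - mu))//.
  by rewrite /q; field; rewrite gt_eqF.
rewrite lee_fin; have := two_point_mgf_le p (lambda * (hi - lo)) p01.
have -> : (lambda * (hi - lo)) ^+ 2 / 8 = lambda ^+ 2 * (hi - lo) ^+ 2 / 8 by rewrite exprMn.
have -> : - (lambda * (hi - lo) * p) = lambda * (lo - mu).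
  by rewrite /p; field; rewrite gt_eqF.
have -> : lambda * (hi - lo) * (1 - p) = lambda * (hi - mu).
  by rewrite /p; field; rewrite gt_eqF.
rewrite -/E1 -/E2 (_ : k * mu + _ = (1 - p) * E1 + p * E2)//.
by rewrite /k /p; field; rewrite gt_eqF.
Qed.

Lemma exp_neg_ratioE (u v : R) : 0 < v -> exp_neg_ratio u v = (expR (- (u / v)))%:E.
Proof. by move=> v0; rewrite /exp_neg_ratio inver gt_eqF. Qed.

Lemma exp_neg_ratio0 (u : R) : 0 < u -> exp_neg_ratio u 0 = 0%E.
Proof.
by move=> u0; rewrite /exp_neg_ratio inver eqxx gt0_muley ?lte_fin//.
Qed.

(** Chernoff's bound with parameter [l], factorization by independence, and [hoeffding_lemma] with
    parameter [l * g i] for each factor. *)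
Lemma hoeffding {I : finType} {X : I -> {RV P >-> R}} {lo hi mu : I -> R}
    (g : I -> R) (V t : R) :
  mutually_independent X ->
  (forall i, {ae P, forall w, lo i <= X i w <= hi i}) ->
  (forall i, 'E_P[X i] = (mu i)%:E)%E ->
  \sum_i (g i * (hi i - lo i)) ^+ 2 <= V -> 0 < t ->
  (P [set w | t <= \sum_i g i * (X i w - mu i)]%R <=
    exp_neg_ratio (2 * t ^+ 2) V)%E.
Proof.
move=> indep Xb EX leV t0.
have mS : measurable_fun setT (fun w => \sum_i g i * (X i w - mu i)).
  apply: measurable_sum => i; apply: measurable_funM => //.
  by apply: measurable_funB => //; exact: measurable_funP.
pose S : {RV P >-> R} := HB.pack (fun w => \sum_i g i * (X i w - mu i))
  (isMeasurableFun.Build _ _ _ _ _ mS).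
have bound (l : R) : 0 < l ->
    (P [set w | t <= S w]%R <= (expR (l ^+ 2 * V / 8 - l * t))%:E)%E.
  move=> l0; apply: (le_trans (chernoff S t l0)).
  rewrite addrC expRD EFinM muleC; apply: lee_pmul => //; rewrite ?lee_fin ?expR_ge0//.
    by apply: expectation_ge0 => w; exact: expR_ge0.
  pose f i z := expR (l * g i * (z - mu i)).
  have mf i : measurable_fun setT (f i).
    apply: measurableT_comp => //; apply: measurable_funM => //.
    exact: measurable_funB.
  have f0 i z : 0 <= f i z by exact: expR_ge0.
  pose m i := fine (\int[P]_w (f i (X i w))%:E)%E.
  have Hb i : (\int[P]_w (f i (X i w))%:E <=
      (expR ((l * g i) ^+ 2 * (hi i - lo i) ^+ 2 / 8))%:E)%E.
    exact: hoeffding_lemma.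
  have fm i : (\int[P]_w (f i (X i w))%:E = (m i)%:E)%E.
    rewrite /m fineK// ge0_fin_numE; last by apply: integral_ge0 => w _; rewrite lee_fin.
    by apply: le_lt_trans (Hb i) _; rewrite ltry.
  rewrite /mmt_gen_fun unlock.
  rewrite (_ : (\int[P]_w _ = \int[P]_w (\prod_i f i (X i w))%:E)%E); last first.
    apply: eq_integral => w _; congr EFin; rewrite /= mulr_suml expR_sum.
    by apply: eq_bigr => i _; rewrite /f; congr expR; ring.
  rewrite (independent_integral_prod indep mf f0 fm) lee_fin.
  apply: (@le_trans _ _ (\prod_i expR ((l * g i) ^+ 2 * (hi i - lo i) ^+ 2 / 8))).
    apply: ler_prod => i _; rewrite -!lee_fin -fm Hb andbT.
    by apply: integral_ge0 => w _; rewrite lee_fin.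
  rewrite -expR_sum ler_expR -mulr_suml ler_pM2r ?invr_gt0//.
  apply: le_trans (ler_wpM2l (sqr_ge0 l) leV); rewrite mulr_sumr.
  by apply: ler_sum => i _; rewrite !exprMn -[leLHS]mulrA.
have V0 : 0 <= V by apply: le_trans leV; apply: sumr_ge0 => i _; exact: sqr_ge0.
move: V0; rewrite le_eqVlt => /predU1P[V0|V0].
  rewrite -V0 in bound *; rewrite exp_neg_ratio0 ?mulr_gt0 ?exprn_gt0//.
  have mE : measurable [set w | t <= S w]%R.
    rewrite -[X in measurable X]setTI.
    exact: (measurable_fun_le measurableT (measurable_cst t) mS).
  have pE : P [set w | t <= S w]%R = (fine (P [set w | t <= S w]%R))%:E.
    by rewrite fineK// fin_num_measure.
  rewrite pE in bound *; set p := fine _ in bound *.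
  rewrite lee_fin leNgt; apply/negP => p0.
  (* For V = 0 the bound is P <= exp (- l t) for all l > 0; l = 1 / (p t) suffices. *)
  have := bound (p * t)^-1; rewrite invr_gt0 mulr_gt0// lee_fin => /(_ isT).
  rewrite mulr0 mul0r add0r invfM mulfVK ?gt_eqF// expRN -[_^-1 in leRHS]mul1r ler_pdivlMr ?expR_gt0//.
  apply/negP; rewrite -ltNge.
  have : p * (1 + p^-1) <= p * expR p^-1 by rewrite ler_pM2l// expR_ge1Dx.
  by rewrite mulrDr mulr1 mulfV ?gt_eqF//; lra.
(* The choice [l = 4 * t / V] minimizes the exponent [l ^+ 2 * V / 8 - l * t], with value
   [- (2 * t ^+ 2 / V)]. *)
rewrite exp_neg_ratioE//; apply: le_trans (bound (4 * t / V) _) _.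
  by rewrite divr_gt0// mulr_gt0.
rewrite lee_fin ler_expR le_eqVlt; apply/orP; left; apply/eqP.
by field; rewrite gt_eqF.
Qed.

End hoeffding.

(** * Random scalings *)

Section finite_extrema.
Context {R : realType} {I : finType}.
Implicit Type f : I -> R.

Lemma fin_min_le f i : fin_min f <= f i.
Proof. by apply: (@ge_bigmin_seq _ _ _ _ _ (f i)) => //; exact: codom_f. Qed.

Lemma fin_max_ge f i : f i <= fin_max f.
Proof. by apply: (@le_bigmax_seq _ _ _ _ _ (f i)) => //; exact: codom_f. Qed.

Lemma fin_min_attained f (i0 : I) : exists i, fin_min f = f i.
Proof.
suff /codomP : fin_min f \in codom f by [].
rewrite /fin_min big_seq; apply: (big_ind (fun z => z \in codom f)) => //.
  by case: (codom f) (codom_f f i0) => // z s _; exact: mem_head.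
by move=> z t zf tf; rewrite /Num.min; case: ifP.
Qed.

Lemma fin_min_gt0 f (i0 : I) : (forall i, 0 < f i) -> 0 < fin_min f.
Proof. by move=> f0; have [i ->] := fin_min_attained f i0. Qed.

Lemma measurable_fin_min {disp : measure_display} {T : measurableType disp}
    (F : I -> T -> R) : (forall i, measurable_fun setT (F i)) ->
  measurable_fun setT (fun w => fin_min (F ^~ w)).
Proof.
move=> mF; rewrite /fin_min /codom /image_mem.
have mh (s : seq I) : measurable_fun setT (fun w => head 0 [seq F i w | i <- s]).
  by case: s => [|i s] //=; exact: measurable_cst.
(* The initial value of the iterated minimum also varies with [w], so the induction allows any
   measurable initial value. *)
have mb (s : seq I) (z : T -> R) : measurable_fun setT z ->
    measurable_fun setT (fun w => \big[Num.min/z w]_(v <- [seq F i w | i <- s]) v).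
  move=> mz; elim: s => [|i s IH].
    by under eq_fun do rewrite big_nil.
  by under eq_fun do rewrite /= big_cons; exact: measurable_minr.
by apply: mb; exact: mh.
Qed.

End finite_extrema.

Section measurable_scaling.
Context {disp : measure_display} {T : measurableType disp} {R : realType}
  {P : probability T R}.

Lemma measurable_inv_gt0 (f : T -> R) : measurable_fun setT f ->
  (forall w, 0 < f w) -> measurable_fun setT (fun w => (f w)^-1).
Proof.
move=> mf f0; under eq_fun => w do rewrite -powR_inv1 ?ltW//.
by apply: (measurableT_comp (measurable_powR (-1))).
Qed.

Lemma measurable_sqrt_gt0 (f : T -> R) : measurable_fun setT f ->
  (forall w, 0 < f w) -> measurable_fun setT (fun w => Num.sqrt (f w)).
Proof.
move=> mf f0; under eq_fun => w do rewrite -powR12_sqrt ?ltW//.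
by apply: (measurableT_comp (measurable_powR (2^-1))).
Qed.

(** Every operation of the iteration preserves measurability, and so does the pointwise limit. The
    remaining freedom, multiplying [xt] and dividing [yt] by a common factor, is spent on equating
    the two minimal ratios. *)
Lemma exists_random_scaling {I J : finType} {B : I -> J -> {RV P >-> R}}
    {r x : I -> R} {c y : J -> R} (i0 : I) (j0 : J) :
  (forall i j w, 0 < B i j w) -> (forall i, 0 < r i) -> (forall j, 0 < c j) ->
  (forall i, 0 < x i) -> (forall j, 0 < y j) -> \sum_i r i = \sum_j c j ->
  exists (xt : I -> {RV P >-> R}) (yt : J -> {RV P >-> R}), forall w,
    [/\ forall i, 0 < xt i w, forall j, 0 < yt j w,
      forall i, \sum_j xt i w * B i j w * yt j w = r i,
      forall j, \sum_i xt i w * B i j w * yt j w = c j &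
      fin_min (fun i => xt i w / x i) = fin_min (fun j => yt j w / y j)].
Proof.
move=> B0 r0 c0 x0 y0 rc.
pose Bw w i j := B i j w.
have Bw0 w i j : 0 < Bw w i j by exact: B0.
pose Y j w := lim (sinkhorn (Bw w) r c n j @[n --> \oo]).
have mB i j : measurable_fun setT (B i j) by exact: measurable_funP.
have mRow (z : J -> T -> R) : (forall j, measurable_fun setT (z j)) ->
    (forall j w, 0 < z j w) -> forall i,
    measurable_fun setT (fun w => row_factor (Bw w) r (z ^~ w) i).
  move=> mz z0 i; apply: measurable_funM => //; apply: measurable_inv_gt0.
    by apply: measurable_sum => j; exact: measurable_funM.
  by move=> w; rewrite (bigD1 j0)//= ltr_wpDr ?mulr_gt0// sumr_ge0// => j _; rewrite mulr_ge0// ltW.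
have mS n : forall j, measurable_fun setT (fun w => sinkhorn (Bw w) r c n j).
  elim: n => [|n IH] j; first exact: measurable_cst.
  rewrite /=; apply: measurable_funM => //; apply: measurable_inv_gt0.
    apply: measurable_sum => i; apply: measurable_funM => //.
    by apply: mRow => // k w; exact: sinkhorn_gt0.
  move=> w; have pos i : 0 < row_factor (Bw w) r (sinkhorn (Bw w) r c n) i * Bw w i j.
    by rewrite mulr_gt0// row_factor_gt0// => k; exact: sinkhorn_gt0.
  by rewrite (bigD1 i0)//= ltr_wpDr// sumr_ge0// => i _; exact: ltW.
have YP w : [/\ forall j, 0 < Y j w,
    forall j, sinkhorn (Bw w) r c n j @[n --> \oo] --> Y j w &
    forall j, sinkhorn_step (Bw w) r c (Y ^~ w) j = Y j w].
  have [z [z0 zcvg zfix]] := sinkhorn_cvg i0 j0 (Bw0 w) r0 c0 rc.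
  have -> : Y ^~ w = z by apply/funext => j; exact/cvg_lim.
  by split => // j; rewrite /Y (cvg_lim _ (zcvg j)).
have Y0 j w : 0 < Y j w by case: (YP w).
have mY j : measurable_fun setT (Y j).
  apply: (@measurable_fun_cvg _ _ _ _ (fun n w => sinkhorn (Bw w) r c n j)) => //.
  by move=> w _; case: (YP w).
pose X i w := row_factor (Bw w) r (Y ^~ w) i.
have X0 i w : 0 < X i w by exact: row_factor_gt0.
have mX i : measurable_fun setT (X i) by exact: mRow.
pose mu w := fin_min (fun i => X i w / x i).
pose mv w := fin_min (fun j => Y j w / y j).
have mu0 w : 0 < mu w by apply: (fin_min_gt0 _ i0) => i; rewrite divr_gt0.
have mv0 w : 0 < mv w by apply: (fin_min_gt0 _ j0) => j; rewrite divr_gt0.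
have mmu : measurable_fun setT mu.
  by apply: measurable_fin_min => i; exact: measurable_funM.
have mmv : measurable_fun setT mv.
  by apply: measurable_fin_min => j; exact: measurable_funM.
(* Chosen so that [al w * mu w = (al w)^-1 * mv w]. *)
pose al w := Num.sqrt (mv w / mu w).
have al0 w : 0 < al w by rewrite sqrtr_gt0 divr_gt0.
have mal : measurable_fun setT al.
  apply: measurable_sqrt_gt0 => [|w]; last by rewrite divr_gt0.
  by apply: measurable_funM => //; exact: measurable_inv_gt0.
have mxt i : measurable_fun setT (fun w => al w * X i w) by exact: measurable_funM.
have myt j : measurable_fun setT (fun w => (al w)^-1 * Y j w).
  by apply: measurable_funM => //; exact: measurable_inv_gt0.
pose xt i : {RV P >-> R} := HB.pack (fun w => al w * X i w)
  (isMeasurableFun.Build _ _ _ _ _ (mxt i)).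
pose yt j : {RV P >-> R} := HB.pack (fun w => (al w)^-1 * Y j w)
  (isMeasurableFun.Build _ _ _ _ _ (myt j)).
exists xt, yt => w.
have E i j : xt i w * B i j w * yt j w = X i w * Bw w i j * Y j w.
  by rewrite /= /Bw; field; rewrite gt_eqF.
have minZ (K : finType) (k0 : K) (k : R) (f : K -> R) : 0 < k ->
    fin_min (fun i => k * f i) = k * fin_min f.
  move=> kgt0; apply/le_anti/andP; split.
    by have [i ->] := fin_min_attained f k0; exact: fin_min_le.
  by have [i ->] := fin_min_attained (fun i => k * f i) k0; rewrite ler_pM2l// fin_min_le.
have Xmin : fin_min (fun i => xt i w / x i) = al w * mu w.
  rewrite -(minZ _ i0)//; congr fin_min.
  by apply/funext => i; rewrite /= mulrA.
have Ymin : fin_min (fun j => yt j w / y j) = (al w)^-1 * mv w.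
  rewrite -(minZ _ j0) ?invr_gt0//; congr fin_min.
  by apply/funext => j; rewrite /= mulrA.
split.
- by move=> i; rewrite mulr_gt0.
- by move=> j; rewrite mulr_gt0// invr_gt0.
- move=> i; under eq_bigr do rewrite E.
  exact: row_factorK.
- move=> j; under eq_bigr do rewrite E.
  have [_ _ fix_] := YP w; rewrite -[in LHS]fix_; exact: sinkhorn_stepK.
- rewrite Xmin Ymin; apply: (mulfI (lt0r_neq0 (al0 w))).
  rewrite mulrA -expr2 mulrA divff ?gt_eqF// mul1r sqr_sqrtr ?divfK ?gt_eqF//.
  by rewrite divr_ge0// ltW.
Qed.

End measurable_scaling.

(** * Deviation probability of one row *)

Section deviation.
Context {disp : measure_display} {T : measurableType disp} {R : realType}
  {P : probability T R}.

Lemma exp_neg_ratio_scale (k u v : R) : 0 < k -> 0 < u -> 0 <= v ->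
  exp_neg_ratio (k * u) (k * v) = exp_neg_ratio u v.
Proof.
move=> k0 u0; rewrite le_eqVlt => /predU1P[<-|v0].
  by rewrite mulr0 !exp_neg_ratio0// mulr_gt0.
rewrite !exp_neg_ratioE ?mulr_gt0//; congr (expR (- _))%:E.
by field; rewrite !gt_eqF.
Qed.

Lemma exp_neg_ratio_fin (u v : R) : 0 < u -> 0 <= v ->
  exists z : R, exp_neg_ratio u v = z%:E.
Proof.
move=> u0; rewrite le_eqVlt => /predU1P[<-|v0].
  by exists 0; rewrite exp_neg_ratio0.
by exists (expR (- (u / v))); rewrite exp_neg_ratioE.
Qed.

Lemma measure_fin_union_le {K : finType} (E : K -> set T) (S : set T) :
  (forall k, measurable (E k)) -> measurable S -> S `<=` \bigcup_k E k ->
  (P S <= \sum_k P (E k))%E.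
Proof.
move=> mE mS SE.
have mU (s : seq K) : measurable (\big[setU/set0]_(k <- s) E k).
  by apply: bigsetU_measurable => k _; exact: mE.
apply: (@le_trans _ _ (P (\big[setU/set0]_k E k))).
  apply: le_measure; rewrite ?inE//.
  by move=> w /SE [k _ Ekw]; rewrite (bigD1 k)//=; left.
elim: (index_enum K) => [|k s IH]; first by rewrite !big_nil measure0.
rewrite !big_cons; apply: le_trans (measureU2 _ _ _) _ => //.
by rewrite leeD2l.
Qed.

Lemma scaled_deviation_measurable {J : finType} {X : J -> {RV P >-> R}}
  (g mu : J -> R) (t : R) :
  measurable [set w | t <= `|\sum_j g j * (X j w - mu j)|].
Proof.
rewrite -[X in measurable X]setTI.
apply: (measurable_fun_le measurableT (measurable_cst t)).
apply: measurableT_comp => //; apply: measurable_sum => j.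
by apply: measurable_funM => //; apply: measurable_funB => //; exact: measurable_funP.
Qed.

(** Hoeffding's inequality with weights [x i * y j / r i], each at most [c j * b / (a ^+ 2 * s)] by
    [scaling_factors_le]. The threshold [delta / 2] produces the [Num.sqrt 2], and the two signs
    produce the factor 2. *)
Lemma scaled_deviation_prob {I J : finType} {At : I -> J -> {RV P >-> R}}
    {A lo hi : I -> J -> R} {a b d s delta : R} {x r : I -> R} {y c : J -> R}
    (i : I) :
  mutually_independent (fun j => At i j) ->
  (forall j, {ae P, forall w, lo i j <= At i j w <= hi i j}) ->
  (forall j, 'E_P[At i j] = (A i j)%:E)%E ->
  0 < a -> (forall i j, a <= A i j <= b) -> (forall j, hi i j - lo i j <= d) ->
  (forall i, 0 < x i) -> (forall j, 0 < y j) ->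
  (forall i, 0 < r i) -> (forall j, 0 < c j) ->
  (forall i, \sum_j x i * A i j * y j = r i) ->
  (forall j, \sum_i x i * A i j * y j = c j) ->
  \sum_i r i = s -> 0 < delta ->
  (P [set w | delta / 2 <= `|\sum_j x i * y j / r i * (At i j w - A i j)|]%R <=
   2%:E * exp_neg_ratio (delta ^+ 2 * s ^+ 2)
            ((Num.sqrt 2 * (b * d / a ^+ 2)) ^+ 2 * \sum_j c j ^+ 2))%E.
Proof.
move=> indep Atb EA a0 Ab hld x0 y0 r0 c0 Ar Ac rs delta0.
have s0 : 0 < s.
  by rewrite -rs (bigD1 i)//= ltr_wpDr// sumr_ge0// => k _; exact: ltW.
pose g j := x i * y j / r i.
pose V := (b * d / a ^+ 2) ^+ 2 * (\sum_j c j ^+ 2) / s ^+ 2.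
have V0 : 0 <= V.
  by rewrite divr_ge0 ?sqr_ge0// mulr_ge0 ?sqr_ge0// sumr_ge0// => j _; exact: sqr_ge0.
have hl0 j : 0 <= hi i j - lo i j.
  by have := expectation_ae_bounds (Atb j) (EA j); lra.
have gV : \sum_j (g j * (hi i j - lo i j)) ^+ 2 <= V.
  rewrite /V mulrAC mulr_sumr; apply: ler_sum => j _.
  have -> : (b * d / a ^+ 2) ^+ 2 / s ^+ 2 * c j ^+ 2 =
      (c j * b / (a ^+ 2 * s) * d) ^+ 2.
    by field; rewrite !gt_eqF.
  have g0 : 0 <= g j by rewrite divr_ge0 ?(ltW (r0 i))// mulr_ge0// ltW.
  rewrite ler_sqr ?nnegrE; last 2 first.
    - exact: mulr_ge0.
    - have b0 : 0 <= b by case/andP: (Ab i j) => ? ?; lra.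
      apply: mulr_ge0; last exact: le_trans (hl0 j) (hld j).
      apply: divr_ge0; first by rewrite mulr_ge0// ltW.
      by rewrite mulr_ge0 ?sqr_ge0// ltW.
  apply: ler_pM => //.
  rewrite /g ler_pdivrMr// mulrAC ler_pdivlMr ?mulr_gt0 ?exprn_gt0//.
  rewrite (_ : c j * b * r i = r i * c j * b); last by ring.
  exact: scaling_factors_le.
have t0 : 0 < delta / 2 by rewrite divr_gt0.
(* Both arguments are multiplied by [2 * s ^+ 2], which also covers [V = 0]. *)
have V' : exp_neg_ratio (2 * (delta / 2) ^+ 2) V =
    exp_neg_ratio (delta ^+ 2 * s ^+ 2)
      ((Num.sqrt 2 * (b * d / a ^+ 2)) ^+ 2 * \sum_j c j ^+ 2).
  rewrite -(exp_neg_ratio_scale (2 * s ^+ 2)) ?mulr_gt0 ?exprn_gt0//.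
  congr exp_neg_ratio; first by field.
  by rewrite exprMn sqr_sqrtr// /V; field; rewrite !gt_eqF.
have H1 := hoeffding g V _ indep Atb EA gV t0.
have H2 : (P [set w | delta / 2 <= \sum_j - g j * (At i j w - A i j)]%R <=
    exp_neg_ratio (2 * (delta / 2) ^+ 2) V)%E.
  apply: (hoeffding (fun j => - g j) V _ indep Atb EA _ t0).
  by under eq_bigr do rewrite mulNr sqrrN.
have mE (h : J -> R) : measurable [set w | delta / 2 <= \sum_j h j * (At i j w - A i j)].
  rewrite -[X in measurable X]setTI.
  apply: (measurable_fun_le measurableT (measurable_cst _)).
  apply: measurable_sum => j.
  by apply: measurable_funM => //; apply: measurable_funB => //; exact: measurable_funP.
rewrite -V'.
apply: (@le_trans _ _ (P ([set w | delta / 2 <= \sum_j g j * (At i j w - A i j)]%R `|`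
   [set w | delta / 2 <= \sum_j - g j * (At i j w - A i j)]%R))).
  apply: le_measure; rewrite ?inE.
  - exact: scaled_deviation_measurable.
  - by apply: measurableU; exact: mE.
  - move=> w /=; rewrite ler_normr => /orP[h|h]; [by left|right].
    by rewrite -sumrN in h; under eq_bigr do rewrite mulNr.
apply: le_trans (measureU2 _ _ _) _; [exact: mE|exact: mE|].
have [z zE] := exp_neg_ratio_fin _ _ (mulr_gt0 (ltr0n _ 2) (exprn_gt0 2 t0)) V0.
rewrite zE in H1 H2 *.
by apply: le_trans (leeD H1 H2) _; rewrite -EFinM -EFinD lee_fin; lra.
Qed.

End deviation.

(** * From row and column deviations to the scaling factors *)

Theorem theorem3 (R : realType) (disp : measure_display)
    (T : measurableType disp) (P : probability T R)
    (M N : nat) (M_gt0 : (0 < M)%N) (N_gt0 : (0 < N)%N)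
    (r : 'rV[R]_M) (c : 'rV[R]_N)
    (r_pos : positive_mx r) (c_pos : positive_mx c)
    (s : R) (r_sum : norm1 r = s) (c_sum : norm1 c = s)
    (At : 'I_M -> 'I_N -> {RV P >-> R})
    (At_pos : forall w, positive_mx (mx_at At w))
    (A : 'M[R]_(M, N))
    (A_mean : forall i j, ('E_P[At i j] = (A i j)%:E)%E)
    (x : 'rV[R]_M) (y : 'rV[R]_N)
    (x_pos : positive_mx x) (y_pos : positive_mx y)
    (xy_norm : norm1 x = norm1 y)
    (xy_scales : scales A r c x y)
    (lo hi : 'M[R]_(M, N))
    (lo_pos : positive_mx lo)
    (At_bounds : forall i j, {ae P, forall w, lo i j <= At i j w <= hi i j})
    (rows_indep : forall i, mutually_independent (fun j => At i j))
    (cols_indep : forall j, mutually_independent (fun i => At i j)) :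
  let a := fin_min (fun k : 'I_M * 'I_N => lo k.1 k.2) in
  let b := fin_max (fun k : 'I_M * 'I_N => hi k.1 k.2) in
  let d := fin_max (fun k : 'I_M * 'I_N => hi k.1 k.2 - lo k.1 k.2) in
  let Cp := Num.sqrt 2 * (b * d / a ^+ 2) in
  let Ce := 1 + 2 * (b / a) `^ (7 / 2) in
  exists (xt : 'I_M -> {RV P >-> R}) (yt : 'I_N -> {RV P >-> R}),
    (forall w, positive_mx (rv_at xt w) /\ positive_mx (rv_at yt w) /\
       scales (mx_at At w) r c (rv_at xt w) (rv_at yt w)) /\
    forall delta : R, 0 < delta <= 1 ->
      (1 - (2 * M)%:R%:E *
             exp_neg_ratio (delta ^+ 2 * s ^+ 2) (Cp ^+ 2 * norm2 c ^+ 2)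
         - (2 * N)%:R%:E *
             exp_neg_ratio (delta ^+ 2 * s ^+ 2) (Cp ^+ 2 * norm2 r ^+ 2)
       <= P [set w | forall (i : 'I_M) (j : 'I_N),
              `|xt i w - x 0 i| / x 0 i
                <= Ce * delta * s / (M%:R * fin_min (fun k => r 0 k)) /\
              `|yt j w - y 0 j| / y 0 j
                <= Ce * delta * s / (N%:R * fin_min (fun k => c 0 k))]%R)%E.
Proof.
move=> a b d Cp Ce.
pose i0 := Ordinal M_gt0; pose j0 := Ordinal N_gt0.
have r0 i : 0 < r 0 i by exact: r_pos.
have c0 j : 0 < c 0 j by exact: c_pos.
have x0 i : 0 < x 0 i by exact: x_pos.
have y0 j : 0 < y 0 j by exact: y_pos.
have [Ar Ac] := xy_scales.
have rs : \sum_i r 0 i = s.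
  by rewrite -r_sum; apply: eq_bigr => i _; rewrite gtr0_norm.
have cs : \sum_j c 0 j = s.
  by rewrite -c_sum; apply: eq_bigr => j _; rewrite gtr0_norm.
have a_lo i j : a <= lo i j by exact: (fin_min_le _ (i, j)).
have hi_b i j : hi i j <= b by exact: (fin_max_ge (fun k => hi k.1 k.2) (i, j)).
have hl_d i j : hi i j - lo i j <= d.
  exact: (fin_max_ge (fun k => hi k.1 k.2 - lo k.1 k.2) (i, j)).
have a0 : 0 < a by apply: (fin_min_gt0 _ (i0, j0)) => k; exact: lo_pos.
have A_lohi i j : lo i j <= A i j <= hi i j.
  exact: expectation_ae_bounds (At_bounds i j) (A_mean i j).
have Ab i j : a <= A i j <= b.
  have /andP[h1 h2] := A_lohi i j.
  by rewrite (le_trans (a_lo i j))//= (le_trans h2).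
have ab : a <= b by case/andP: (Ab i0 j0); exact: le_trans.
have s0 : 0 < s.
  by rewrite -rs (bigD1 i0)//= ltr_wpDr// sumr_ge0// => k _; exact: ltW.
have At0 i j w : 0 < At i j w by have := At_pos w i j; rewrite mxE.
have [xt [yt sc]] := exists_random_scaling i0 j0 At0 r0 c0 x0 y0 (etrans rs (esym cs)).
exists xt, yt; split.
  move=> w; have [xt0 yt0 Br Bc _] := sc w; split; last split; last split.
  - by move=> i j; rewrite ord1 mxE.
  - by move=> i j; rewrite ord1 mxE.
  - by move=> i; rewrite -Br; apply: eq_bigr => j _; rewrite !mxE.
  - by move=> j; rewrite -Bc; apply: eq_bigr => i _; rewrite !mxE.
move=> delta /andP[delta0 delta1].
pose rowdev i := [set w | delta / 2 <=
  `|\sum_j x 0 i * y 0 j / r 0 i * (At i j w - A i j)|].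
pose coldev j := [set w | delta / 2 <=
  `|\sum_i x 0 i * y 0 j / c 0 j * (At i j w - A i j)|].
have norm2E n (v : 'rV[R]_n) : norm2 v ^+ 2 = \sum_j v 0 j ^+ 2.
  rewrite /norm2 sqr_sqrtr; last by apply: sumr_ge0 => j _; exact: sqr_ge0.
  by apply: eq_bigr => j _; rewrite real_normK ?num_real.
have Prow i : (P (rowdev i) <= 2%:E *
    exp_neg_ratio (delta ^+ 2 * s ^+ 2) (Cp ^+ 2 * norm2 c ^+ 2))%E.
  rewrite norm2E; apply: (@scaled_deviation_prob _ _ _ _ _ _ At A lo hi a b d s delta
    (fun i => x 0 i) (fun i => r 0 i) (fun j => y 0 j) (fun j => c 0 j)) => //.
have Pcol j : (P (coldev j) <= 2%:E *
    exp_neg_ratio (delta ^+ 2 * s ^+ 2) (Cp ^+ 2 * norm2 r ^+ 2))%E.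
  rewrite norm2E (_ : coldev j = [set w | delta / 2 <=
    `|\sum_i y 0 j * x 0 i / c 0 j * (At i j w - A i j)|]); last first.
    by rewrite /coldev; under eq_set => w do under eq_bigr do rewrite (mulrC (x 0 _)).
  (* A column is a row of the transposed matrix. *)
  apply: (@scaled_deviation_prob _ _ _ _ _ _ (fun j i => At i j) (fun j i => A i j)
    (fun j i => lo i j) (fun j i => hi i j) a b d s delta
    (fun j => y 0 j) (fun j => c 0 j) (fun i => x 0 i) (fun i => r 0 i)) => //.
  - by move=> k; rewrite -Ac; apply: eq_bigr => i _; ring.
  - by move=> i; rewrite -Ar; apply: eq_bigr => k _; ring.
set G := [set w | _].
have mG : measurable G.
  rewrite (_ : G = \bigcap_(i in [set: 'I_M]) \bigcap_(j in [set: 'I_N])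
    ([set w | `|xt i w - x 0 i| / x 0 i
       <= Ce * delta * s / (M%:R * fin_min (fun k => r 0 k))] `&`
     [set w | `|yt j w - y 0 j| / y 0 j
       <= Ce * delta * s / (N%:R * fin_min (fun k => c 0 k))])); last first.
    apply/seteqP; split => w /= h; first by move=> i _ j _; exact: h.
    by move=> i j; exact: h.
  have mle (Z : {RV P >-> R}) (z k : R) : measurable [set w | `|Z w - z| / z <= k].
    rewrite -[X in measurable X]setTI.
    apply: (measurable_fun_le measurableT _ (measurable_cst k)).
    apply: measurable_funM => //; apply: measurableT_comp => //.
    by apply: measurable_funB => //; exact: measurable_funP.
  apply: fin_bigcap_measurable => // i _; apply: fin_bigcap_measurable => // j _.
  by apply: measurableI; exact: mle.
have mrow i : measurable (rowdev i) by exact: scaled_deviation_measurable.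
have mcol j : measurable (coldev j) by exact: scaled_deviation_measurable.
pose dev (k : 'I_M + 'I_N) := match k with inl i => rowdev i | inr j => coldev j end.
(* The entry bounds hold only almost surely; their exceptional sets are collected in one null
   set. *)
have [Z [mZ PZ Zb]] : exists Z : set T, [/\ measurable Z, P Z = 0%E &
    forall w, ~ Z w -> forall i j, lo i j <= At i j w <= hi i j].
  have [Z ZP] := choice (fun k : 'I_M * 'I_N => At_bounds k.1 k.2).
  have mZ k : measurable (Z k) by case: (ZP k).
  have mUZ : measurable (\bigcup_k Z k) by exact: fin_bigcup_measurable.
  exists (\bigcup_k Z k); split=> //.
    apply/eqP; rewrite eq_le measure_ge0 andbT.
    apply: le_trans (measure_fin_union_le Z _ mZ mUZ (fun _ => id)) _.
    by rewrite big1// => k _; case: (ZP k).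
  move=> w nZ i j; apply: contrapT => h; apply: nZ.
  by have [_ _ /(_ w h)] := ZP (i, j) => Zw; exists (i, j).
(* The deterministic part: without a large deviation, the perturbation estimate applies with
   [e = delta / 2]. *)
have Gdev w : ~ Z w -> (forall k, ~ dev k w) -> G w.
  move=> nZ ndev.
  have Bb i j : a <= At i j w <= b.
    have /andP[h1 h2] := Zb w nZ i j.
    by rewrite (le_trans (a_lo i j))//= (le_trans h2).
  have [xt0 yt0 Br Bc mineq] := sc w.
  set t := fin_min (fun j => yt j w / y 0 j) in mineq.
  have tx i : t <= xt i w / x 0 i by rewrite -mineq; exact: (fin_min_le (fun i => xt i w / x 0 i)).
  have ty j : t <= yt j w / y 0 j by exact: (fin_min_le (fun j => yt j w / y 0 j)).
  have [i1 ti1] := fin_min_attained (fun i => xt i w / x 0 i) i0.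
  have [j1 tj1] := fin_min_attained (fun j => yt j w / y 0 j) j0.
  rewrite mineq in ti1; rewrite -/t in tj1.
  have d2 : 0 <= delta / 2 <= 2^-1 by lra.
  have rowd i : `|\sum_j x 0 i * y 0 j / r 0 i * (At i j w - A i j)| <= delta / 2.
    by apply: ltW; rewrite ltNge; apply/negP; exact: (ndev (inl i)).
  have cold j : `|\sum_i x 0 i * y 0 j / c 0 j * (At i j w - A i j)| <= delta / 2.
    by apply: ltW; rewrite ltNge; apply/negP; exact: (ndev (inr j)).
  have Hx := @scaling_ratio_dist _ _ _ (fun i j => A i j) (fun i j => At i j w)
    a b (delta / 2) t (fun i => x 0 i) (fun i => xt i w) (fun i => r 0 i)
    (fun j => y 0 j) (fun j => yt j w) (fun j => c 0 j) i1 j1 a0 Ab Bb x0 y0 xt0 yt0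
    r0 c0 d2 Ar Ac Br Bc rowd cold tx ty (esym ti1) (esym tj1).
  have Hy : forall j, `|yt j w - y 0 j| / y 0 j <= delta / 2 * (3 + 2 * (b / a) ^+ 2).
    apply: (@scaling_ratio_dist _ _ _ (fun j i => A i j) (fun j i => At i j w)
      a b (delta / 2) t (fun j => y 0 j) (fun j => yt j w) (fun j => c 0 j)
      (fun i => x 0 i) (fun i => xt i w) (fun i => r 0 i) j1 i1) => //.
    - by move=> j; rewrite -Ac; apply: eq_bigr => i _; ring.
    - by move=> i; rewrite -Ar; apply: eq_bigr => j _; ring.
    - by move=> j; rewrite -Bc; apply: eq_bigr => i _; ring.
    - by move=> i; rewrite -Br; apply: eq_bigr => j _; ring.
    - by move=> j; under eq_bigr do rewrite (mulrC (y 0 _)); exact: cold.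
    - by move=> i; under eq_bigr do rewrite (mulrC (y 0 _)); exact: rowd.
  have ba1 : 1 <= b / a by rewrite ler_pdivlMr// mul1r.
  (* Since [b / a >= 1], the constant [3 / 2 + (b / a) ^+ 2] is at most [1 + 2 * (b / a) ^+ 2], and
     the exponent 2 may be raised to [7 / 2]. *)
  have CeE : delta / 2 * (3 + 2 * (b / a) ^+ 2) <= Ce * delta.
    have h1 : 1 <= (b / a) ^+ 2 by exact: exprn_ege1.
    have h2 : (b / a) ^+ 2 <= (b / a) `^ (7 / 2).
      rewrite -powR_mulrn ?(le_trans ler01)//; apply: ler_powR => //; lra.
    rewrite (_ : delta / 2 * _ = (3 + 2 * (b / a) ^+ 2) / 2 * delta); last by ring.
    rewrite ler_pM2r// /Ce; lra.
  (* The sum [s] is at least [n] times the smallest entry, so the extra factor in the target is at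
     least 1. *)
  have bound n (v : 'rV[R]_n) (k0 : 'I_n) : (forall k, 0 < v 0 k) ->
      \sum_k v 0 k = s -> Ce * delta <= Ce * delta * s / (n%:R * fin_min (fun k => v 0 k)).
    move=> v0 vs; have n0 : (0 < n)%N by exact: leq_ltn_trans (ltn_ord k0).
    have m0 : 0 < fin_min (fun k => v 0 k) by exact: fin_min_gt0.
    rewrite ler_pdivlMr ?mulr_gt0 ?ltr0n// ler_wpM2l//.
      by rewrite mulr_ge0 ?(ltW delta0)// addr_ge0// mulr_ge0// powR_ge0.
    have -> : n%:R * fin_min (fun k => v 0 k) = \sum_(k < n) fin_min (fun k => v 0 k).
      by rewrite sumr_const card_ord mulr_natl.
    by rewrite -vs; apply: ler_sum => k _; exact: (fin_min_le (fun k => v 0 k)).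
  move=> i j; split.
    by apply: le_trans (Hx i) (le_trans CeE _); exact: bound.
  by apply: le_trans (Hy j) (le_trans CeE _); exact: bound.
(* Union bound over all rows, all columns and, as one further index, the null set [Z]. *)
have PGc : (P (~` G) <= \sum_(k : 'I_M + 'I_N + unit)
    P (if k is inl k' then dev k' else Z))%E.
  apply: measure_fin_union_le.
  - by case=> [[i|j]|] /=.
  - exact: measurableC.
  - move=> w nG; apply: contrapT => h; apply: nG; apply: Gdev.
      by move=> Zw; apply: h; exists (inr tt).
    by move=> k devk; apply: h; exists (inl k).
have ds0 : 0 < delta ^+ 2 * s ^+ 2 by rewrite mulr_gt0 ?exprn_gt0.
(* Both exponential terms are finite, so the rest is linear arithmetic over the reals. *)
have [p pE] := exp_neg_ratio_fin _ _ ds0 (mulr_ge0 (sqr_ge0 Cp) (sqr_ge0 (norm2 c))).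
have [q qE] := exp_neg_ratio_fin _ _ ds0 (mulr_ge0 (sqr_ge0 Cp) (sqr_ge0 (norm2 r))).
rewrite pE in Prow *; rewrite qE in Pcol *.
have {}PGc : (P (~` G) <= (M%:R * (2 * p) + N%:R * (2 * q))%:E)%E.
  apply: (le_trans PGc); rewrite !big_sumType/= [X in (_ + X)%E]big1// adde0 EFinD.
  have sum_cst n (z : R) : (n%:R * z)%:E = (\sum_(i < n) z%:E)%E.
    by rewrite sumEFin sumr_const card_ord mulr_natl.
  by apply: leeD; rewrite sum_cst; apply: lee_sum => k _; rewrite EFinM.
have PGfin : P G = (fine (P G))%:E by rewrite fineK// fin_num_measure.
rewrite probability_setC// PGfin in PGc; rewrite PGfin.
move: PGc; rewrite -!EFinM -!EFinB !lee_fin !natrM; lra.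
Qed.
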